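(* For any normal functional $H$ of type $2$, the type structure $\mathcal M^H$ is a model of $\mathsf{QF\text{-}AC}^{0,1}$, $\neg\mathsf{PIT}_{\mathsf u}$, $\mathsf{PIT}_o$, $(\forall M_o)\neg\mathsf{WPR}(M_o)$, and $(\forall M_u)\neg\mathsf{PR}(M_u)$.
   Context: A type $2$ functional $H$ is normal if the functional $\exists^2$ (with $\exists^2(f)=0\leftrightarrow(\exists n)(f(n)=0)$, values in $\{0,1\}$) is Kleene-computable (S1–S9) in $H$. The type structure $\mathcal M^H=\{\mathcal M^H_k\}_k$ is given by $\mathcal M^H_0=\mathbb N$ and $\mathcal M^H_{k+1}$ = all $\phi:\mathcal M^H_k\to\mathbb N$ Kleene-computable in $H$. $\mathsf{QF\text{-}AC}^{0,1}$: $(\forall n^0)(\exists f^1)A(n,f)\to(\exists Y^{0\to1})(\forall n)A(n,Y(n))$ for quantifier-free $A$. $C=2^{\mathbb N}$; $\overline{f}n=\langle f(0),\dots,f(n-1)\rangle$; $[\sigma]$ = set of $g\in C$ extending $\sigma$. $\mathsf{LOC}(F,G)\equiv(\forall f,g\in C)(g\in[\overline{f}G(f)]\to F(g)\le G(f))$ for $F,G:C\to\mathbb N$. $\mathsf{PIT}_o$: $(\forall F,G:C\to\mathbb N)(\exists N)[\mathsf{LOC}(F,G)\to(\forall g\in C)(F(g)\le N)]$. $\mathsf{PIT}_{\mathsf u}$: $(\forall G:C\to\mathbb N)(\exists N)(\forall F:C\to\mathbb N)[\mathsf{LOC}(F,G)\to(\forall g\in C)(F(g)\le N)]$. $\mathsf{PR}(M)$: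 $(\forall F,G)[\mathsf{LOC}(F,G)\to(\forall g\in C)(F(g)\le M(G))]$. $\mathsf{WPR}(M_o)$: $(\forall F,G)[\mathsf{LOC}(F,G)\to(\forall f\in C)(F(f)\le M_o(F,G))]$. *)

(* Defs.v *)
From Stdlib Require Import Arith List Cantor.
Import ListNotations.

Fixpoint T (k : nat) : Type :=
  match k with 0 => nat | S k' => T k' -> nat end.

Definition Obj := { k : nat & T k }.
Definition onum (n : nat) : Obj := existT T 0 n.

Inductive Sch :=
| S1 | S2 (q : nat) | S3 | S4 (e1 e2 : nat) | S5 (e1 e2 : nat)
| S6 (i e1 : nat) | S7 | S8 (e1 : nat) | S9 (m : nat).

Definition dec (e : nat) : Sch :=
  let (t, r) := of_nat e in
  match t with
  | 0 => S1
  | 1 => S2 r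
  | 2 => S3
  | 3 => let (a, b) := of_nat r in S4 a b
  | 4 => let (a, b) := of_nat r in S5 a b
  | 5 => let (a, b) := of_nat r in S6 a b
  | 6 => S7
  | 7 => S8 r
  | _ => S9 r
  end.

Definition removenth {A} (i : nat) (l : list A) : list A := firstn i l ++ skipn (S i) l.

(** Kleene computation {e}(args) = n (schemes S1-S9).  [P j] is the domain of
    objects of type j over which the lambda-abstraction in S8 must be total
    (for M^H this is membership in M^H_j). *)
Inductive Comp (P : forall j, T j -> Prop) : nat -> list Obj -> nat -> Prop :=
| c1 e (x : nat) rest : dec e = S1 -> Comp P e (onum x :: rest) (S x)
| c2 e q args : dec e = S2 q -> Comp P e args q
| c3 e (x : nat) rest : dec e = S3 -> Comp P e (onum x :: rest) x
| c4 e e1 e2 args m n : dec e = S4 e1 e2 -> Comp P e2 args m ->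
    Comp P e1 (onum m :: args) n -> Comp P e args n
| c5a e e1 e2 rest n : dec e = S5 e1 e2 -> Comp P e1 rest n ->
    Comp P e (onum 0 :: rest) n
| c5b e e1 e2 (x : nat) rest m n : dec e = S5 e1 e2 ->
    Comp P e (onum x :: rest) m ->
    Comp P e2 (onum m :: onum x :: rest) n ->
    Comp P e (onum (S x) :: rest) n
| c6 e i e1 args n : dec e = S6 i e1 -> i < length args ->
    Comp P e1 (nth i args (onum 0) :: removenth i args) n -> Comp P e args n
| c7 e (f : nat -> nat) (x : nat) rest : dec e = S7 ->
    Comp P e (existT T 1 f :: onum x :: rest) (f x)
| c8 e e1 j (F : T (S (S j))) rest (psi : T (S j)) n : dec e = S8 e1 ->
    (forall G : T j, P j G ->
       Comp P e1 (existT T j G :: existT T (S (S j)) F :: rest) (psi G)) ->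
    n = F psi ->
    Comp P e (existT T (S (S j)) F :: rest) n
| c9 e m (a : nat) args n : dec e = S9 m -> m <= length args ->
    Comp P a (firstn m args) n -> Comp P e (onum a :: args) n.

Definition eqv (P : forall j, T j -> Prop) (k : nat) : T k -> T k -> Prop :=
  match k return T k -> T k -> Prop with
  | 0 => fun x y => x = y
  | S m => fun x y => forall z : T m, P m z -> x z = y z
  end.

Definition NewMem (H : T 2) (k : nat) (P : forall j, T j -> Prop) (phi : T (S k)) : Prop :=
  (forall x y : T k, P k x -> eqv P k x y -> phi x = phi y) /\
  exists e, forall x : T k, P k x ->
    Comp P e [existT T k x; existT T 2 H] (phi x).

(** Stage k: membership in M^H_j for all j <= k (False for j > k). *)
Fixpoint Stage (H : T 2) (k : nat) : forall j, T j -> Prop :=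
  match k with
  | 0 => fun j _ => j = 0
  | S k' => fun j x =>
      Stage H k' j x \/
      exists E : j = S k', NewMem H k' (Stage H k') (eq_rect j T x (S k') E)
  end.

(** x is (a representative of) an element of M^H_k. *)
Definition Mem (H : T 2) (k : nat) (x : T k) : Prop := Stage H k k x.

Definition normal (H : (nat -> nat) -> nat) : Prop :=
  exists e, forall f : nat -> nat, exists n,
    Comp (Stage H 0) e [existT T 1 f; existT T 2 H] n /\
    (n = 0 <-> exists m, f m = 0) /\ (n = 0 \/ n = 1).

Definition binary (f : nat -> nat) : Prop := forall n, f n <= 1.
Definition extends_init (f g : nat -> nat) (n : nat) : Prop :=
  forall i, i < n -> g i = f i.

Definition LOC (H : T 2) (F G : T 2) : Prop :=
  forall f g : nat -> nat, Mem H 1 f -> binary f -> Mem H 1 g -> binary g ->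
    extends_init f g (G f) -> F g <= G f.

Definition bounded_on_C (H : T 2) (F : T 2) (N : nat) : Prop :=
  forall g : nat -> nat, Mem H 1 g -> binary g -> F g <= N.

Definition PITo (H : T 2) : Prop :=
  forall F G : T 2, Mem H 2 F -> Mem H 2 G ->
    exists N, LOC H F G -> bounded_on_C H F N.

Definition PITu (H : T 2) : Prop :=
  forall G : T 2, Mem H 2 G ->
    exists N, forall F : T 2, Mem H 2 F -> LOC H F G -> bounded_on_C H F N.

Definition PR (H : T 2) (M : T 3) : Prop :=
  forall F G : T 2, Mem H 2 F -> Mem H 2 G -> LOC H F G -> bounded_on_C H F (M G).

Definition pair2 (F G : T 2) : T 2 :=
  fun f => if f 0 =? 0 then F (fun n => f (S n)) else G (fun n => f (S n)).

(** WPR(M_o), M_o of type (2 x 2) -> 0, coded as type 3 acting on pair2 F G. *)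
Definition WPR (H : T 2) (Mo : T 3) : Prop :=
  forall F G : T 2, Mem H 2 F -> Mem H 2 G -> LOC H F G ->
    bounded_on_C H F (Mo (pair2 F G)).

Definition cons0 (n : nat) (f : nat -> nat) : nat -> nat :=
  fun k => match k with 0 => n | S k' => f k' end.

(** QF-AC^{0,1} in M^H: the universal closure of the instance
    A(n,f) :== Phi(n,f) = 0 with Phi a parameter of type 0 -> 1 -> 0
    (coded as type 2 via (n,f) |-> n :: f); Y^{0->1} coded as a type-1
    object via Cantor pairing: Y(n) = fun m => Y (to_nat (n,m)). *)
Definition QFAC01 (H : T 2) : Prop :=
  forall Phi : T 2, Mem H 2 Phi ->
    (forall n, exists f : nat -> nat, Mem H 1 f /\ Phi (cons0 n f) = 0) ->
    exists Y : nat -> nat, Mem H 1 Y /\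
      forall n, Phi (cons0 n (fun m => Y (to_nat (n, m)))) = 0.

(* Main.v *)
(** Every element of M^H_1 has an index, and since H is normal, Gandy selection finds
    an index of a total function with a decidable property computably in H. Selecting
    witnesses gives QF-AC^{0,1}. Selecting an index of f, plus 1, gives an injective
    G in M^H_2. For each N some binary g differs at d from the function with
    G-value d + 1, for all d < N; so g lies in [f|G(f)] only if G(f) > N, and the F that
    is N + 1 at g and 0 elsewhere satisfies LOC(F, G). This refutes PIT_u, hence PR.
    For WPR, a computation of M_o at (0, G) queries its first argument only on a
    sequence of functions enumerated computably in H along its subcomputations;
    g can be chosen off that sequence, so M_o does not notice the change from 0 to F.
    For PIT_o, if F were unbounded, QF-AC^{0,1} would give f_n in C with F(f_n) > n;
    these have a cluster point f arithmetical in them, and LOC(F, G) fails at f.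

    Kleene computations are simulated by an inductively defined interpreter, itself
    computable in H; only the forward direction of both simulations is needed. The
    comparison behind Gandy selection decides which of two configurations halts, given
    that one does, by stepping both; it needs no ordinal norms. *)

Require Import Defs.
From Stdlib Require Import Arith List Cantor Lia Eqdep_dec FunctionalExtensionality ClassicalEpsilon.
Import ListNotations.

(** Arguments of [Comp] are dependent pairs and realising indices are specified in one direction
    only, so analysing a computation backwards there is awkward. Every such analysis takes place in
    [Eval], a deterministic relation on numbers: computations map into it ([simulation]), it maps
    back into computations ([realise]), and uniqueness of Kleene values is inherited from it. The
    Boolean [b] treats two contexts at once: [[H]], whose realisable functions are members of type
    1, and [[f; H]], which yields members of type 2. The flag in a configuration is forced by the
    injectivity of [G]: an index selected while [f] is available must denote the same function when
    the parameter is another [f'], so candidates are run with the parameter switched off. Before a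
    type-2 argument given by an index is applied, the interpreter evaluates the whole function it is
    applied to. Thus every query that [M_o] makes to its argument is the family of some
    subcomputation, where the enumeration meets it and the diagonal construction can avoid it. *)

Definition pr (x y : nat) : nat := to_nat (x, y).
Definition p1 (z : nat) : nat := fst (of_nat z).
Definition p2 (z : nat) : nat := snd (of_nat z).

Lemma p1_pr x y : p1 (pr x y) = x.
Proof. unfold p1, pr. now rewrite cancel_of_to. Qed.

Lemma p2_pr x y : p2 (pr x y) = y.
Proof. unfold p2, pr. now rewrite cancel_of_to. Qed.

Lemma pr_p z : pr (p1 z) (p2 z) = z.
Proof. unfold p1, p2, pr. rewrite <- surjective_pairing. apply cancel_to_of. Qed.

Lemma dec_eq e : dec e =
  match p1 e with
  | 0 => S1 | 1 => S2 (p2 e) | 2 => S3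
  | 3 => S4 (p1 (p2 e)) (p2 (p2 e)) | 4 => S5 (p1 (p2 e)) (p2 (p2 e))
  | 5 => S6 (p1 (p2 e)) (p2 (p2 e)) | 6 => S7 | 7 => S8 (p2 e) | _ => S9 (p2 e)
  end.
Proof.
  unfold dec, p1, p2. destruct (of_nat e) as [t r]; cbn [fst snd].
  destruct (of_nat r); cbn [fst snd]. reflexivity.
Qed.

Lemma dec_pr t r : dec (pr t r) =
  match t with
  | 0 => S1 | 1 => S2 r | 2 => S3
  | 3 => S4 (p1 r) (p2 r) | 4 => S5 (p1 r) (p2 r)
  | 5 => S6 (p1 r) (p2 r) | 6 => S7 | 7 => S8 r | _ => S9 r
  end.
Proof. now rewrite dec_eq, p1_pr, p2_pr. Qed.

Definition oH (H : T 2) : Obj := existT T 2 H.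
Definition oF (f : T 1) : Obj := existT T 1 f.

Lemma existT_T_inj j (x y : T j) : existT T j x = existT T j y -> x = y.
Proof. apply inj_pair2_eq_dec, Nat.eq_dec. Qed.

Lemma removenth_middle {A} (l l' : list A) y : removenth (length l) (l ++ y :: l') = l ++ l'.
Proof. induction l as [|x l IH]; unfold removenth in *; simpl; [|f_equal]; auto. Qed.

(* On arguments of type at most 2, S8 only abstracts over numbers, so the
   domain of the higher types is irrelevant. *)
Lemma Comp_dom (P P' : forall j, T j -> Prop) e args v :
  (forall x, P 0 x) -> Forall (fun o : Obj => projT1 o <= 2) args ->
  Comp P e args v -> Comp P' e args v.
Proof.
  intros HP low C. induction C.
  - now apply c1.
  - now apply c2.
  - now apply c3.
  - eapply c4; [eassumption|auto|]. apply IHC2. constructor; simpl; auto with arith.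
  - eapply c5a; eauto. apply IHC. now inversion low.
  - inversion low; subst. eapply c5b; [eassumption| |].
    + apply IHC1. constructor; simpl; auto with arith.
    + apply IHC2. repeat (constructor; simpl; auto with arith).
  - eapply c6; eauto. apply IHC. rewrite Forall_forall in *.
    intros o [<-|Ho].
    + apply low. now apply nth_In.
    + apply low. unfold removenth in Ho. apply in_app_or in Ho.
      rewrite <- (firstn_skipn i args), in_app_iff. destruct Ho as [Ho|Ho]; auto.
      right. rewrite <- (firstn_skipn 1 (skipn i args)). apply in_or_app; right.
      now rewrite skipn_skipn.
  - now apply c7.
  - assert (j = 0) as -> by (inversion low; subst; simpl in *; lia).
    apply (c8 _ _ e1 0 F rest psi); auto.
  - eapply c9; [eassumption|assumption|]. apply IHC.
    apply Forall_inv_tail in low. rewrite Forall_forall in *. intros o Ho. apply low.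
    rewrite <- (firstn_skipn m args), in_app_iff; auto.
Qed.

(** * Realisable partial relations *)

Section Ctx.
Variables (H : T 2) (b : bool).

Definition ctx (f : nat -> nat) : list Obj :=
  if b then [oF f; oH H] else [oH H].

Definition ap (f : nat -> nat) (x : nat) : nat := if b then f x else 0.

Definition lenctx : nat := if b then 2 else 1.

Lemma length_ctx f : length (ctx f) = lenctx.
Proof. unfold ctx, lenctx. now destruct b. Qed.

(* The type-1 parameter followed by n numbers; the last number is the first
   argument of the program. *)
Fixpoint env (n : nat) : Type :=
  match n with 0 => nat -> nat | S k => (env k * nat)%type end.

Fixpoint nums (n : nat) : env n -> list Obj :=
  match n with 0 => fun _ => [] | S k => fun a => onum (snd a) :: nums k (fst a) end.

Fixpoint par (n : nat) : env n -> nat -> nat :=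
  match n with 0 => fun f => f | S k => fun a => par k (fst a) end.

Lemma length_nums n (a : env n) : length (nums n a) = n.
Proof. induction n; simpl; auto. Qed.

Definition K : nat -> list Obj -> nat -> Prop := Comp (Stage H 0).

(* Only one direction is required of the realising index, and it must ignore
   trailing arguments; this is what lets S6 discard arguments. *)
Definition Realisable (n : nat) (R : env n -> nat -> Prop) : Prop :=
  exists e, forall a v rest, R a v -> K e (nums n a ++ ctx (par n a) ++ rest) v.

Definition RealisableFun (n : nat) (phi : env n -> nat) :
Prop := Realisable n (fun a v => v = phi a).

(** S6 moves a single argument to the front. Used [m] times at the fixed position [n + m - 1], it
    brings the block [B] forward, last element first, which preserves the order of [B]. *)
Lemma rotate_args m : forall n e, exists e', forall A B C v,
  length A = n -> length B = m -> K e (B ++ A ++ C) v -> K e' (A ++ B ++ C) v.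
Proof.
  induction m as [|m IH]; intros n e.
  - exists e. intros A B C v _ HB. destruct B; [auto|discriminate].
  - destruct (IH (S n) e) as [e1 He1].
    exists (pr 5 (pr (n + m) e1)). intros A B C v HA HB HC.
    destruct (exists_last (l := B)) as [B' [y ->]]; [now intros ->|].
    rewrite length_app in HB; simpl in HB.
    eapply c6 with (i := n + m) (e1 := e1).
    + rewrite dec_pr. now rewrite p1_pr, p2_pr.
    + rewrite !length_app; simpl; lia.
    + assert (L : A ++ (B' ++ [y]) ++ C = (A ++ B') ++ y :: C)
        by now rewrite <- !app_assoc.
      assert (LL : length (A ++ B') = n + m) by (rewrite length_app; lia).
      rewrite L, <- LL, nth_middle, removenth_middle.
      rewrite <- app_assoc. apply (He1 (y :: A) B' C); simpl; try lia.
      now rewrite <- !app_assoc in HC.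
Qed.

Lemma swap_args i n m e : exists e', forall A B C D v,
  length A = i -> length B = n -> length C = m ->
  K e (A ++ C ++ B ++ D) v -> K e' (A ++ B ++ C ++ D) v.
Proof.
  destruct (rotate_args i m e) as [e1 He1], (rotate_args m (i + n) e1) as [e2 He2].
  exists e2. intros A B C D v HA HB HC HK.
  rewrite (app_assoc A). apply He2; auto. { rewrite length_app; lia. }
  rewrite <- app_assoc. now apply He1.
Qed.

(** These relations describe a program by the values it must be able to return; [rIf] asks nothing
    of the branch not taken. *)
Definition rLet (Q : nat -> Prop) (R : nat -> nat -> Prop) (v : nat) : Prop :=
  exists w, Q w /\ R w v.
Definition rIf (t : nat) (R0 R1 : nat -> Prop) (v : nat) : Prop :=
  (t = 0 /\ R0 v) \/ (t <> 0 /\ R1 v).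
Definition rAp (F : T 2) (R : nat -> nat -> Prop) (v : nat) : Prop :=
  exists g, (forall m, R m (g m)) /\ v = F g.

Lemma pe_mono n (R R' : env n -> nat -> Prop) :
  Realisable n R -> (forall a v, R' a v -> R a v) -> Realisable n R'.
Proof. intros [e He] HR. exists e. auto. Qed.

Lemma pe_let n (Q : env n -> nat -> Prop) (R : env n -> nat -> nat -> Prop) :
  Realisable n Q -> Realisable (S n) (fun q v => R (fst q) (snd q) v) ->
  Realisable n (fun a v => rLet (Q a) (R a) v).
Proof.
  intros [e2 H2] [e1 H1]. exists (pr 3 (pr e1 e2)).
  intros a v rest (w & Hw & HR). eapply c4.
  - now rewrite dec_pr, p1_pr, p2_pr.
  - exact (H2 a w rest Hw).
  - exact (H1 (a, w) v rest HR).
Qed.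

Lemma pe_weak n (R : env n -> nat -> Prop) :
  Realisable n R -> Realisable (S n) (fun q v => R (fst q) v).
Proof.
  intros [e He]. destruct (rotate_args (n + lenctx) 1 e) as [e' He'].
  exists e'. intros [a x] v rest HR.
  simpl. rewrite app_assoc.
  apply (He' [onum x] (nums n a ++ ctx (par n a)) rest v); auto.
  - now rewrite length_app, length_nums, length_ctx.
  - rewrite <- app_assoc. now apply He.
Qed.

Lemma cf_const n c : RealisableFun n (fun _ => c).
Proof.
  exists (pr 1 c). intros a v rest ->. apply c2. now rewrite dec_pr.
Qed.

Lemma cf_weak n phi : RealisableFun n phi -> RealisableFun (S n) (fun q => phi (fst q)).
Proof. apply pe_weak. Qed.

Lemma cf_v0 n : RealisableFun (S n) (fun q => snd q).
Proof.
  exists (pr 2 0). intros [a x] v rest ->. apply c3. now rewrite dec_pr.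
Qed.

Lemma cf_v1 n : RealisableFun (S (S n)) (fun q => snd (fst q)).
Proof. exact (cf_weak _ _ (cf_v0 n)). Qed.
Lemma cf_v2 n : RealisableFun (S (S (S n))) (fun q => snd (fst (fst q))).
Proof. exact (cf_weak _ _ (cf_v1 n)). Qed.
Lemma cf_v3 n : RealisableFun (S (S (S (S n)))) (fun q => snd (fst (fst (fst q)))).
Proof. exact (cf_weak _ _ (cf_v2 n)). Qed.
Lemma cf_v4 n : RealisableFun (S (S (S (S (S n))))) (fun q => snd (fst (fst (fst (fst q))))).
Proof. exact (cf_weak _ _ (cf_v3 n)). Qed.

Lemma pe_sub n s (R : env n -> nat -> nat -> Prop) :
  RealisableFun n s -> Realisable (S n) (fun q v => R (fst q) (snd q) v) ->
  Realisable n (fun a v => R a (s a) v).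
Proof.
  intros Hs HR. eapply pe_mono. { apply pe_let; eassumption. }
  intros a v h. now exists (s a).
Qed.

Lemma cf_sub n s (phi : env n -> nat -> nat) :
  RealisableFun n s -> RealisableFun (S n) (fun q => phi (fst q) (snd q)) ->
  RealisableFun n (fun a => phi a (s a)).
Proof. intros Hs Hphi. exact (pe_sub n s (fun a x v => v = phi a x) Hs Hphi). Qed.

Lemma cf_S n s : RealisableFun n s -> RealisableFun n (fun a => S (s a)).
Proof.
  intros Hs. apply (cf_sub n s (fun _ x => S x) Hs).
  exists (pr 0 0). intros [a x] v rest ->. apply c1. now rewrite dec_pr.
Qed.

Definition prec (z : nat) (s : nat -> nat -> nat) (t : nat) : nat :=
  nat_rec (fun _ => nat) z s t.

Lemma cf_prec n z (s : env n -> nat -> nat -> nat) t :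
  RealisableFun n z ->
  RealisableFun (S (S n)) (fun q => s (fst (fst q)) (snd (fst q)) (snd q)) -> RealisableFun n t ->
  RealisableFun n (fun a => prec (z a) (s a) (t a)).
Proof.
  intros [ez Hz] [es Hs] Ht.
  apply (cf_sub n t (fun a x => prec (z a) (s a) x) Ht).
  exists (pr 4 (pr ez es)). intros [a x] v rest ->. simpl.
  assert (D : dec (pr 4 (pr ez es)) = S5 ez es) by now rewrite dec_pr, p1_pr, p2_pr.
  induction x as [|x IH].
  - eapply c5a; [exact D|]. now apply Hz.
  - eapply c5b; [exact D|exact IH|].
    now apply (Hs (a, x, prec (z a) (s a) x)).
Qed.

Definition ifz (t u v : nat) : nat := match t with 0 => u | S _ => v end.

Lemma cf_ifz n t u v : RealisableFun n t -> RealisableFun n u -> RealisableFun n v ->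
  RealisableFun n (fun a => ifz (t a) (u a) (v a)).
Proof.
  intros Ht Hu Hv.
  assert (E : (fun a => ifz (t a) (u a) (v a)) = (fun a => prec (u a) (fun _ _ => v a) (t a))).
  { extensionality a. unfold ifz, prec. destruct (t a); reflexivity. }
  rewrite E. apply (cf_prec n u (fun a _ _ => v a)); auto.
  exact (cf_weak _ _ (cf_weak _ _ Hv)).
Qed.

Lemma pe_if n t (R0 R1 : env n -> nat -> Prop) :
  RealisableFun n t -> Realisable n R0 -> Realisable n R1 ->
  Realisable n (fun a v => rIf (t a) (R0 a) (R1 a) v).
Proof.
  intros Ht [e0 H0] [e1 H1].
  (* S5 would evaluate both branches; instead compute the index of the branch
     and run it with S9. *)
  apply pe_mono with
    (R := fun a v => K (ifz (t a) e0 e1) (nums n a ++ ctx (par n a)) v).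
  - apply (pe_sub n (fun a => ifz (t a) e0 e1)
             (fun a i v => K i (nums n a ++ ctx (par n a)) v)).
    { apply cf_ifz; auto using cf_const. }
    exists (pr 8 (n + lenctx)). intros [a i] v rest HK. simpl in *.
    eapply c9.
    + now rewrite dec_pr.
    + rewrite !length_app, length_nums, length_ctx. lia.
    + rewrite app_assoc, firstn_app, length_app, length_nums, length_ctx, Nat.sub_diag.
      rewrite firstn_O, app_nil_r, firstn_all2; auto.
      rewrite length_app, length_nums, length_ctx. lia.
  - intros a v [[E h]|[E h]].
    + rewrite E. simpl. rewrite <- (app_nil_r (ctx _)). now apply H0.
    + unfold ifz. destruct (t a); [easy|]. rewrite <- (app_nil_r (ctx _)). now apply H1.
Qed.

(** S8 wants [H] as first argument, so S6 fetches it from the end of the context; the body of the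
    abstraction puts it back behind the numbers. *)
Lemma pe_H n (R : env n -> nat -> nat -> Prop) :
  Realisable (S n) (fun q v => R (fst q) (snd q) v) ->
  Realisable n (fun a v => rAp H (R a) v).
Proof.
  intros [e He]. set (r := lenctx - 1).
  destruct (swap_args 1 1 (n + r) e) as [e1 He1].
  exists (pr 5 (pr (n + r) (pr 7 e1))). intros a v rest (g & Hg & ->).
  assert (Ec : exists pre, length pre = r /\ ctx (par n a) = pre ++ [oH H]).
  { unfold ctx, r, lenctx. destruct b.
    - now exists [oF (par n a)].
    - now exists []. }
  destruct Ec as (pre & Lp & Ec). rewrite Ec.
  assert (L : nums n a ++ (pre ++ [oH H]) ++ rest = (nums n a ++ pre) ++ oH H :: rest)
    by now rewrite <- !app_assoc.
  assert (LL : length (nums n a ++ pre) = n + r) by (rewrite length_app, length_nums; lia).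
  rewrite L. eapply c6.
  - now rewrite dec_pr, p1_pr, p2_pr.
  - rewrite length_app, LL. simpl; lia.
  - rewrite <- LL, nth_middle, removenth_middle.
    apply (c8 _ _ e1 0 H _ g); auto.
    + now rewrite dec_pr.
    + intros m _.
      apply (He1 [onum m] [oH H] (nums n a ++ pre) rest); auto.
      specialize (He (a, m) (g m) rest (Hg m)). simpl in He. rewrite Ec in He.
      now rewrite <- !app_assoc in *.
Qed.

Definition Run (f : nat -> nat) (e x v : nat) : Prop := K e (onum x :: ctx f) v.

Lemma pe_run n z s : RealisableFun n z -> RealisableFun n s ->
  Realisable n (fun a v => Run (par n a) (z a) (s a) v).
Proof.
  intros Hz Hs.
  apply (pe_sub n s (fun a x v => Run (par n a) (z a) x v) Hs).
  apply (pe_sub (S n) (fun q => z (fst q)) (fun q i v => Run (par n (fst q)) i (snd q) v)).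
  { now apply cf_weak. }
  destruct (swap_args 2 n lenctx (pr 8 (1 + lenctx))) as [e He]. exists e.
  intros [[a x] i] v rest HR. simpl in *.
  apply (He [onum i; onum x] (nums n a) (ctx (par n a)) rest); auto using length_nums, length_ctx.
  simpl. eapply c9.
  - now rewrite dec_pr.
  - simpl. rewrite !length_app, length_ctx. lia.
  - simpl. rewrite firstn_app, length_ctx, Nat.sub_diag, firstn_O, app_nil_r, firstn_all2; auto.
    now rewrite length_ctx.
Qed.

Lemma cf_ap n s : RealisableFun n s -> RealisableFun n (fun a => ap (par n a) (s a)).
Proof.
  intros Hs. apply (cf_sub n s (fun a x => ap (par n a) x) Hs).
  destruct b eqn:Eb.
  - exists (pr 5 (pr (S n) (pr 6 0))). intros [a x] v rest ->. simpl.
    unfold ap, ctx. rewrite Eb. simpl. eapply c6.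
    + now rewrite dec_pr, p1_pr, p2_pr.
    + simpl. rewrite length_app, length_nums; simpl; lia.
    + pose proof (length_nums n a) as L.
      change (onum x :: nums n a ++ oF (par n a) :: oH H :: rest)
        with ((onum x :: nums n a) ++ oF (par n a) :: oH H :: rest).
      replace (S n) with (length (onum x :: nums n a)) by (simpl; lia).
      rewrite nth_middle, removenth_middle. apply c7. now rewrite dec_pr.
  - unfold ap. rewrite Eb. apply cf_const.
Qed.

Lemma pe_index (R : env 1 -> nat -> Prop) :
  Realisable 1 R -> exists e, forall f x v, R (f, x) v -> Run f e x v.
Proof.
  intros [e He]. exists e. intros f x v HR. specialize (He (f, x) v [] HR).
  simpl in He. now rewrite app_nil_r in He.
Qed.

(** * Arithmetic functions *)

Lemma cf_weak2 n phi : RealisableFun n phi ->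
  RealisableFun (S (S n)) (fun q => phi (fst (fst q))).
Proof. intros h. exact (cf_weak _ _ (cf_weak _ _ h)). Qed.

Lemma cf_add n s t : RealisableFun n s -> RealisableFun n t ->
  RealisableFun n (fun a => s a + t a).
Proof.
  intros Hs Ht.
  replace (fun a => s a + t a) with (fun a => prec (t a) (fun _ r => S r) (s a)).
  - apply (cf_prec n t (fun _ _ r => S r) s); auto. apply (cf_S (S (S n)) _ (cf_v0 _)).
  - extensionality a. induction (s a) as [|x IH]; [reflexivity|exact (f_equal S IH)].
Qed.

Lemma cf_pred n s : RealisableFun n s -> RealisableFun n (fun a => pred (s a)).
Proof.
  intros Hs.
  replace (fun a => pred (s a)) with (fun a => prec 0 (fun k _ => k) (s a)).
  - apply (cf_prec n (fun _ => 0) (fun _ k _ => k) s); auto using cf_const, cf_v1.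
  - extensionality a. now destruct (s a).
Qed.

Lemma cf_minus n s t : RealisableFun n s -> RealisableFun n t ->
  RealisableFun n (fun a => s a - t a).
Proof.
  intros Hs Ht.
  replace (fun a => s a - t a) with (fun a => prec (s a) (fun _ r => pred r) (t a)).
  - apply (cf_prec n s (fun _ _ r => pred r) t); auto. apply (cf_pred (S (S n)) _ (cf_v0 _)).
  - extensionality a. induction (t a) as [|x IH]; simpl; [lia|].
    unfold prec in *. simpl. rewrite IH. lia.
Qed.

(** * Pairs and coded lists *)

Definition tri (n : nat) : nat := prec 0 (fun k r => S k + r) n.

Lemma cf_tri n s : RealisableFun n s -> RealisableFun n (fun a => tri (s a)).
Proof.
  intros Hs. apply (cf_prec n (fun _ => 0) (fun _ k r => S k + r) s); auto using cf_const.
  apply (cf_add (S (S n)) (fun q => S (snd (fst q))) (fun q => snd q)).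
  - apply cf_S, cf_v1.
  - apply cf_v0.
Qed.

Lemma pr_tri x y : pr x y = y + tri (y + x).
Proof. reflexivity. Qed.

Lemma tri_S n : tri (S n) = S n + tri n.
Proof. reflexivity. Qed.

(** The diagonal of the Cantor pairing on which [n] lies, found by primitive recursion because the
    projections have to be realised by S1-S9 indices. *)
Definition root (n : nat) : nat :=
  prec 0 (fun k r => ifz (tri (S r) - S k) (S r) r) n.

Lemma root_spec n : tri (root n) <= n < tri (S (root n)).
Proof.
  induction n as [|n IH]; [cbn; lia|].
  change (root (S n)) with (ifz (tri (S (root n)) - S n) (S (root n)) (root n)).
  destruct (tri (S (root n)) - S n) eqn:E; cbn [ifz].
  - rewrite !tri_S in *. lia.
  - lia.
Qed.

Lemma tri_mono m n : m <= n -> tri m <= tri n.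
Proof. induction 1; auto. rewrite tri_S. lia. Qed.

Lemma root_eq n : root n = p1 n + p2 n.
Proof.
  pose proof (root_spec n) as h.
  assert (E : n = p2 n + tri (p2 n + p1 n)) by (rewrite <- pr_tri; now rewrite pr_p).
  rewrite (Nat.add_comm (p1 n)). set (s := p2 n + p1 n) in *.
  assert (tri s <= n < tri (S s)) by (rewrite tri_S; lia).
  destruct (Nat.lt_trichotomy (root n) s) as [L|[L|L]]; auto.
  - apply tri_mono in L. lia.
  - apply tri_mono in L. lia.
Qed.

Lemma cf_root n s : RealisableFun n s -> RealisableFun n (fun a => root (s a)).
Proof.
  intros Hs. apply (cf_prec n (fun _ => 0) (fun _ k r => ifz (tri (S r) - S k) (S r) r) s);
    auto using cf_const.
  apply (cf_ifz (S (S n)) (fun q => tri (S (snd q)) - S (snd (fst q)))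
           (fun q => S (snd q)) (fun q => snd q)).
  - apply (cf_minus (S (S n)) (fun q => tri (S (snd q))) (fun q => S (snd (fst q)))).
    + apply (cf_tri (S (S n)) (fun q => S (snd q))), cf_S, cf_v0.
    + apply cf_S, cf_v1.
  - apply cf_S, cf_v0.
  - apply cf_v0.
Qed.

Lemma cf_pr n s t : RealisableFun n s -> RealisableFun n t ->
  RealisableFun n (fun a => pr (s a) (t a)).
Proof.
  intros Hs Ht.
  apply (cf_add n t (fun a => tri (t a + s a)) Ht).
  now apply cf_tri, cf_add.
Qed.

Lemma cf_p2 n s : RealisableFun n s -> RealisableFun n (fun a => p2 (s a)).
Proof.
  intros Hs. replace (fun a => p2 (s a)) with (fun a => s a - tri (root (s a))).
  - now apply cf_minus, cf_tri, cf_root.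
  - extensionality a. rewrite root_eq, (Nat.add_comm (p1 _)).
    enough (s a = p2 (s a) + tri (p2 (s a) + p1 (s a))) by lia.
    rewrite <- pr_tri. now rewrite pr_p.
Qed.

Lemma cf_p1 n s : RealisableFun n s -> RealisableFun n (fun a => p1 (s a)).
Proof.
  intros Hs. replace (fun a => p1 (s a)) with (fun a => root (s a) - p2 (s a)).
  - apply cf_minus; [now apply cf_root|now apply cf_p2].
  - extensionality a. rewrite root_eq. lia.
Qed.

Lemma prec_S z s k : prec z s (S k) = s k (prec z s k).
Proof. reflexivity. Qed.

(** The successor separates nonempty lists from 0, the code of the empty list. *)
Definition consK (s l : nat) : nat := S (pr s l).
Definition hdK (l : nat) : nat := p1 (pred l).
Definition tlK (l : nat) : nat := p2 (pred l).
Definition skipK (i l : nat) : nat := prec l (fun _ r => tlK r) i.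
Definition nthK (i l : nat) : nat := hdK (skipK i l).
Definition catK (m l l' : nat) : nat :=
  prec l' (fun k r => consK (nthK (m - S k) l) r) m.

Fixpoint enc (L : list nat) : nat :=
  match L with [] => 0 | s :: L' => consK s (enc L') end.

Lemma hdK_cons s l : hdK (consK s l) = s.
Proof. unfold hdK, consK. simpl. apply p1_pr. Qed.
Lemma tlK_cons s l : tlK (consK s l) = l.
Proof. unfold tlK, consK. simpl. apply p2_pr. Qed.

Lemma skipK_enc i L : skipK i (enc L) = enc (skipn i L).
Proof.
  induction i as [|i IH]; [reflexivity|].
  change (skipK (S i) (enc L)) with (tlK (skipK i (enc L))). rewrite IH.
  change (S i) with (1 + i). rewrite <- skipn_skipn.
  destruct (skipn i L); [reflexivity|apply tlK_cons].
Qed.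

Lemma nthK_enc i L : nthK i (enc L) = nth i L 0.
Proof.
  unfold nthK. rewrite skipK_enc.
  replace (nth i L 0) with (nth 0 (skipn i L) 0) by (rewrite nth_skipn; f_equal; lia).
  destruct (skipn i L); [reflexivity|apply hdK_cons].
Qed.

Lemma catK_enc m L B : m <= length L -> catK m (enc L) (enc B) = enc (firstn m L ++ B).
Proof.
  intros Hm.
  assert (h : forall k, k <= m ->
    prec (enc B) (fun k r => consK (nthK (m - S k) (enc L)) r) k
    = enc (skipn (m - k) (firstn m L) ++ B)).
  { induction k as [|k IH]; intros Hk.
    - rewrite Nat.sub_0_r, skipn_all2; auto. rewrite length_firstn. lia.
    - rewrite prec_S.
      rewrite IH by lia. rewrite nthK_enc.
      replace (m - k) with (1 + (m - S k)) by lia. rewrite <- skipn_skipn.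
      assert (E : nth (m - S k) L 0 = nth 0 (skipn (m - S k) (firstn m L)) 0).
      { rewrite nth_skipn, nth_firstn.
        replace (m - S k + 0 <? m) with true; [f_equal; lia|].
        symmetry. apply Nat.ltb_lt. lia. }
      rewrite E. assert (length (skipn (m - S k) (firstn m L)) > 0).
      { rewrite length_skipn, length_firstn. lia. }
      destruct (skipn (m - S k) (firstn m L)); [simpl in *; lia|reflexivity]. }
  unfold catK. rewrite h, Nat.sub_diag; auto.
Qed.

Lemma catK_enc_0 m L : m <= length L -> catK m (enc L) 0 = enc (firstn m L).
Proof. intros h. rewrite <- (app_nil_r (firstn m L)). exact (catK_enc m L [] h). Qed.

Lemma cf_consK n s t : RealisableFun n s -> RealisableFun n t ->
  RealisableFun n (fun a => consK (s a) (t a)).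
Proof. intros. now apply cf_S, cf_pr. Qed.
Lemma cf_hdK n s : RealisableFun n s -> RealisableFun n (fun a => hdK (s a)).
Proof. intros. now apply cf_p1, cf_pred. Qed.
Lemma cf_tlK n s : RealisableFun n s -> RealisableFun n (fun a => tlK (s a)).
Proof. intros. now apply cf_p2, cf_pred. Qed.
Lemma cf_skipK n s t : RealisableFun n s -> RealisableFun n t ->
  RealisableFun n (fun a => skipK (s a) (t a)).
Proof.
  intros. apply (cf_prec n t (fun _ _ r => tlK r)); auto.
  apply (cf_tlK (S (S n)) (fun q => snd q)), cf_v0.
Qed.
Lemma cf_nthK n s t : RealisableFun n s -> RealisableFun n t ->
  RealisableFun n (fun a => nthK (s a) (t a)).
Proof. intros. now apply cf_hdK, cf_skipK. Qed.
Lemma cf_catK n s t u : RealisableFun n s -> RealisableFun n t -> RealisableFun n u ->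
  RealisableFun n (fun a => catK (s a) (t a) (u a)).
Proof.
  intros. apply (cf_prec n u (fun a k r => consK (nthK (s a - S k) (t a)) r)); auto.
  apply (cf_consK (S (S n)) (fun q => nthK (s (fst (fst q)) - S (snd (fst q))) (t (fst (fst q))))
           (fun q => snd q)); [|apply cf_v0].
  apply (cf_nthK (S (S n))); [|now apply cf_weak2].
  apply (cf_minus (S (S n)) (fun q => s (fst (fst q))) (fun q => S (snd (fst q)))).
  - now apply cf_weak2.
  - apply cf_S, cf_v1.
Qed.

(** * An interpreter for S1-S9 *)

(* Codes of arguments: a number, the function m |-> {e}(m, l), the type-1 parameter,
   H, and a type-2 functional given by an index. *)
Definition sNum (x : nat) : nat := pr 0 x.
Definition sClo (e l : nat) : nat := pr 1 (pr e l).
Definition sOF : nat := pr 2 0.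
Definition sOH : nat := pr 3 0.
Definition sO2 (c : nat) : nat := pr 4 c.

(* A configuration [pr (head mode fl e l) v] runs index e on the coded list l in
   mode 0, and on v :: l in mode 1; flag 0 disables the type-1 parameter.
   An instruction is either [rt v], which returns v, or [st o a k], which evaluates
   the whole family m |-> pr a m, giving g, and goes on as [pr k w], where w is H g
   for o = 0 and g 0 for o = 1. *)
Definition head (mode fl e l : nat) : nat := pr (pr mode fl) (pr e l).
Definition rt (v : nat) : nat := pr 0 (pr v 0).
Definition st (o a k : nat) : nat := pr (S o) (pr a k).
(** A jump in the form of an instruction: the family [m |-> m] of mode 2 halts at once, and mode 0
    ignores the value passed on. *)
Definition tail (fl e l : nat) : nat := st 1 (head 2 fl 0 0) (head 0 fl e l).

Ltac cf_hook := fail.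

Ltac cf :=
  lazymatch goal with
  | |- RealisableFun _ (fun _ => ?c) => apply cf_const
  | |- RealisableFun _ snd => apply cf_v0
  | |- RealisableFun _ (fun q => snd q) => apply cf_v0
  | |- RealisableFun _ (fun q => snd (fst q)) => apply cf_v1
  | |- RealisableFun _ (fun q => snd (fst (fst q))) => apply cf_v2
  | |- RealisableFun _ (fun q => snd (fst (fst (fst q)))) => apply cf_v3
  | |- RealisableFun _ (fun q => snd (fst (fst (fst (fst q))))) => apply cf_v4
  | |- RealisableFun ?n (fun a => S (@?s a)) => apply (cf_S n s); cf
  | |- RealisableFun ?n (fun a => pred (@?s a)) => apply (cf_pred n s); cf
  | |- RealisableFun ?n (fun a => p1 (@?s a)) => apply (cf_p1 n s); cf
  | |- RealisableFun ?n (fun a => p2 (@?s a)) => apply (cf_p2 n s); cf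
  | |- RealisableFun ?n (fun a => hdK (@?s a)) => apply (cf_hdK n s); cf
  | |- RealisableFun ?n (fun a => tlK (@?s a)) => apply (cf_tlK n s); cf
  | |- RealisableFun ?n (fun a => ap _ (@?s a)) => apply (cf_ap n s); cf
  | |- RealisableFun ?n (fun a => @?s a + @?t a) => apply (cf_add n s t); cf
  | |- RealisableFun ?n (fun a => @?s a - @?t a) => apply (cf_minus n s t); cf
  | |- RealisableFun ?n (fun a => pr (@?s a) (@?t a)) => apply (cf_pr n s t); cf
  | |- RealisableFun ?n (fun a => consK (@?s a) (@?t a)) => apply (cf_consK n s t); cf
  | |- RealisableFun ?n (fun a => skipK (@?s a) (@?t a)) => apply (cf_skipK n s t); cf
  | |- RealisableFun ?n (fun a => nthK (@?s a) (@?t a)) => apply (cf_nthK n s t); cf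
  | |- RealisableFun ?n (fun a => ifz (@?s a) (@?t a) (@?u a)) => apply (cf_ifz n s t u); cf
  | |- RealisableFun ?n (fun a => catK (@?s a) (@?t a) (@?u a)) => apply (cf_catK n s t u); cf
  | |- RealisableFun (S (S ?n)) (fun q => ?s (fst (fst q))) => apply (cf_weak2 n s); cf
  | |- RealisableFun (S ?n) (fun q => ?s (fst q)) => apply (cf_weak n s); cf
  | |- RealisableFun _ (fun a => sNum _) => unfold sNum; cf
  | |- RealisableFun _ (fun a => sClo _ _) => unfold sClo; cf
  | |- RealisableFun _ (fun a => head _ _ _ _) => unfold head; cf
  | |- RealisableFun _ (fun a => rt _) => unfold rt; cf
  | |- RealisableFun _ (fun a => st _ _ _) => unfold st; cf
  | |- RealisableFun _ (fun a => tail _ _ _) => unfold tail; cf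
  | |- _ => first [eassumption | cf_hook | idtac]
  end.
(** The S8 clause separates [H], called directly, from a functional given by an index, whose program
    receives the abstraction as a closure. In the second case the abstraction is still evaluated as
    a family and its value discarded: this enforces totality and makes the query visible among the
    subcomputations. *)
Definition kle (f : nat -> nat) (fl e L : nat) : nat :=
  let t := p1 e in let r := p2 e in let x := p2 (hdK L) in
  ifz t (rt (S x))
  (ifz (t - 1) (rt r)
  (ifz (t - 2) (rt x)
  (ifz (t - 3) (st 1 (head 0 fl (p2 r) L) (head 1 fl (p1 r) L))
  (ifz (t - 4)
    (ifz x (tail fl (p1 r) (tlK L))
      (st 1 (head 0 fl e (consK (sNum (pred x)) (tlK L)))
            (head 1 fl (p2 r) (consK (sNum (pred x)) (tlK L)))))
  (ifz (t - 5)
    (tail fl (p2 r) (consK (nthK (p1 r) L) (catK (p1 r) L (skipK (S (p1 r)) L))))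
  (ifz (t - 6)
    (ifz (p1 (hdK L) - 1)
      (tail fl (p1 x) (consK (nthK 1 L) (p2 x)))
      (rt (ifz fl 0 (ap f (p2 (nthK 1 L))))))
  (ifz (t - 7)
    (ifz (p1 (hdK L) - 3)
      (st 0 (head 1 fl r L) (head 2 fl 0 0))
      (st 1 (head 1 fl r L) (head 0 fl x (consK (sClo r L) (consK sOH 0)))))
  (tail fl x (catK r (tlK L) 0))))))))).

(** In modes 6 and 7, [l] has the form [pr (pr s k) ctx], with the family [s] to be searched, the
    candidate [k], and the coded context. *)
Definition gnext (fl e l : nat) : nat :=
  head 6 fl e (pr (pr (p1 (p1 l)) (S (p2 (p1 l)))) (p2 l)).

(* Realising indices are only known to halt when they should, not to diverge
   otherwise, so the two searches whose halting must be analysed backwards are built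
   into the interpreter: modes 3-5 halt iff v indexes a total function passing the
   test e, and modes 6-8 run Gandy's recursion. *)
Definition kd (f : nat -> nat) (c : nat) : nat :=
  let v := p2 c in let mode := p1 (p1 (p1 c)) in let fl := p2 (p1 (p1 c)) in
  let e := p1 (p2 (p1 c)) in let l := p2 (p2 (p1 c)) in
  ifz mode (kle f fl e l)
  (ifz (mode - 1) (kle f fl e (consK (sNum v) l))
  (ifz (mode - 2) (rt v)
  (ifz (mode - 3)
    (st 1 (head 1 0 v (consK sOH 0)) (head 4 fl e (consK (sNum (pr (p1 l) v)) (p2 l))))
  (ifz (mode - 4) (st 1 (head 0 fl e l) (head 5 fl 0 0))
  (ifz (mode - 5) (ifz v (rt 0) (st 1 (head 5 fl 0 0) (head 5 fl 0 0)))
  (ifz (mode - 6)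
    (st 1 (head 0 fl e (consK (sNum (pr (p1 l) (pr (gnext fl e l) 0))) (p2 l))) (head 7 fl e l))
  (ifz (mode - 7)
    (ifz v (st 1 (head 9 fl (p2 (p1 l)) 0) (p1 (p1 l))) (st 1 (gnext fl e l) (head 8 fl 0 0)))
  (ifz (mode - 8) (rt (S v)) (rt e))))))))).

Lemma cf_kle n fl e L : RealisableFun n fl -> RealisableFun n e -> RealisableFun n L ->
  RealisableFun n (fun a => kle (par n a) (fl a) (e a) (L a)).
Proof. intros. unfold kle. cbv zeta. cf. Qed.

Ltac cf_hook ::=
  lazymatch goal with
  | |- RealisableFun ?n (fun a => kle _ (@?s a) (@?t a) (@?u a)) => apply (cf_kle n s t u); cf
  end.

Lemma cf_kd n s : RealisableFun n s -> RealisableFun n (fun a => kd (par n a) (s a)).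
Proof. intros. unfold kd, gnext. cbv zeta. cf. Qed.

Definition kt f c := p1 (kd f c).
Definition ka f c := p1 (p2 (kd f c)).
Definition kb f c := p2 (p2 (kd f c)).
Lemma cf_kt n s : RealisableFun n s -> RealisableFun n (fun a => kt (par n a) (s a)).
Proof. intros. now apply cf_p1, cf_kd. Qed.
Lemma cf_ka n s : RealisableFun n s -> RealisableFun n (fun a => ka (par n a) (s a)).
Proof. intros. now apply cf_p1, cf_p2, cf_kd. Qed.
Lemma cf_kb n s : RealisableFun n s -> RealisableFun n (fun a => kb (par n a) (s a)).
Proof. intros. now apply cf_p2, cf_p2, cf_kd. Qed.

Ltac cf_hook ::=
  lazymatch goal with
  | |- RealisableFun ?n (fun a => kt _ (@?s a)) => apply (cf_kt n s); cf
  | |- RealisableFun ?n (fun a => ka _ (@?s a)) => apply (cf_ka n s); cf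
  | |- RealisableFun ?n (fun a => kb _ (@?s a)) => apply (cf_kb n s); cf
  end.

(** * Evaluation of configurations *)

Definition op (t : nat) (g : nat -> nat) : nat := ifz (t - 1) (H g) (g 0).

Inductive Eval (f : nat -> nat) : nat -> nat -> Prop :=
| Eval_ret c : kt f c = 0 -> Eval f c (ka f c)
| Eval_step c g v : kt f c <> 0 -> (forall m, Eval f (pr (ka f c) m) (g m)) ->
    Eval f (pr (kb f c) (op (kt f c) g)) v -> Eval f c v.

Lemma Eval_fun f c v : Eval f c v -> forall v', Eval f c v' -> v = v'.
Proof.
  induction 1 as [c E|c g v E Hg IHg Hk IHk]; intros v' h; inversion h; subst; try congruence.
  assert (g = g0) as <- by (extensionality m; auto). auto.
Qed.

Lemma Eval_kd f c c' v : kd f c = kd f c' -> Eval f c v -> Eval f c' v.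
Proof.
  intros E h. assert (Et : kt f c = kt f c') by (unfold kt; now rewrite E).
  assert (Ea : ka f c = ka f c') by (unfold ka; now rewrite E).
  assert (Eb : kb f c = kb f c') by (unfold kb; now rewrite E).
  destruct h as [c h|c g v h hg hk].
  - rewrite Ea. apply Eval_ret. congruence.
  - apply Eval_step with g; rewrite <- ?Et, <- ?Ea, <- ?Eb; auto.
Qed.

Lemma Eval_rt f c v : kd f c = rt v -> Eval f c v.
Proof.
  intros E. replace v with (ka f c).
  - apply Eval_ret. unfold kt, rt in *. now rewrite E, p1_pr.
  - unfold ka, rt in *. now rewrite E, p2_pr, p1_pr.
Qed.

Lemma Eval_st f c o a k g v : kd f c = st o a k ->
  (forall m, Eval f (pr a m) (g m)) -> Eval f (pr k (op (S o) g)) v -> Eval f c v.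
Proof.
  intros E hg hk. unfold st in E.
  apply Eval_step with g; unfold kt, ka, kb; rewrite E, ?p2_pr, ?p1_pr, ?p2_pr; auto.
Qed.

Lemma Eval_st_inv f c o a k v : kd f c = st o a k -> Eval f c v ->
  exists g, (forall m, Eval f (pr a m) (g m)) /\ Eval f (pr k (op (S o) g)) v.
Proof.
  intros E h. unfold st in E.
  inversion h as [c' h0|c' g v' h0 hg hk]; subst; unfold kt, ka, kb in *;
    rewrite E, ?p2_pr, ?p1_pr, ?p2_pr in *; [easy|]. eauto.
Qed.

Lemma Eval_rt_inv f c w v : kd f c = rt w -> Eval f c v -> v = w.
Proof. intros E h. apply (Eval_fun _ _ _ h). now apply Eval_rt. Qed.

Ltac kd_simpl := unfold kd, head; rewrite ?p1_pr, ?p2_pr; cbn [ifz Nat.sub]; rewrite ?p1_pr, ?p2_pr.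

Lemma kd_0 f fl e l v : kd f (pr (head 0 fl e l) v) = kle f fl e l.
Proof. kd_simpl. reflexivity. Qed.
Lemma kd_1 f fl e l v : kd f (pr (head 1 fl e l) v) = kle f fl e (consK (sNum v) l).
Proof. kd_simpl. reflexivity. Qed.
Lemma kd_2 f fl e l v : kd f (pr (head 2 fl e l) v) = rt v.
Proof. kd_simpl. reflexivity. Qed.

Lemma Eval_tail f c fl e l v : kd f c = tail fl e l -> Eval f (pr (head 0 fl e l) 0) v ->
  Eval f c v.
Proof.
  intros E h. apply (Eval_st _ _ _ _ _ (fun m => m) v E); auto.
  intros m. apply Eval_rt, kd_2.
Qed.

Lemma Eval_mode1 f fl e l m w v :
  Eval f (pr (head 1 fl e l) m) v <-> Eval f (pr (head 0 fl e (consK (sNum m) l)) w) v.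
Proof. split; apply Eval_kd; now rewrite kd_0, kd_1. Qed.

(* [z] is the index of the interpreter itself: passing it as an argument replaces
   the recursion theorem. *)
Definition realB (f : nat -> nat) (z c : nat) : nat -> Prop :=
  rIf (kt f c) (fun v => v = ka f c)
    (rLet
      (rIf (kt f c - 1)
        (rAp H (fun m => Run f z (pr z (pr (ka f c) m))))
        (Run f z (pr z (pr (ka f c) 0))))
      (fun w => Run f z (pr z (pr (kb f c) w)))).

Ltac pe_hook := fail.

Ltac pe :=
  cbv beta;
  try lazymatch goal with
  | |- Realisable ?n (fun a v => _) => idtac
  | |- Realisable ?n (fun a => @?R a) => change (Realisable n (fun a v => R a v)); cbv beta
  end;
  lazymatch goal with
  | |- Realisable ?n (fun a v => v = @?t a) => change (RealisableFun n t); cf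
  | |- Realisable ?n (fun a v => rLet (@?Q a) (@?R a) v) => apply (pe_let n Q R); pe
  | |- Realisable ?n (fun a v => rIf (@?t a) (@?Q a) (@?R a) v) => apply (pe_if n t Q R); [cf|pe|pe]
  | |- Realisable ?n (fun a v => rAp H (@?R a) v) => apply (pe_H n R); pe
  | |- Realisable ?n (fun a v => Run _ (@?z a) (@?s a) v) => apply (pe_run n z s); cf
  | |- _ => first [pe_hook | idtac]
  end.

Lemma pe_realB : Realisable 1 (fun q v => realB (fst q) (p1 (snd q)) (p2 (snd q)) v).
Proof. unfold realB. pe. Qed.

Lemma realise : exists u, forall f c v, Eval f c v -> Run f u c v.
Proof.
  destruct (pe_index _ pe_realB) as [z Hz].
  (* The index [u] starts the interpreter [z] on its own index. *)
  destruct (pe_index (fun q v => Run (fst q) z (pr z (snd q)) v)) as [u Hu].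
  { apply (pe_run 1); cf. }
  exists u. intros f c v h. apply Hu. simpl.
  induction h as [c E|c g v E Hg IHg Hk IHk]; apply Hz; simpl; rewrite p1_pr, p2_pr.
  - now left.
  - right. split; auto. exists (op (kt f c) g). split; auto.
    unfold op. destruct (kt f c - 1) eqn:Ek; [left|right]; simpl; auto.
    split; auto. now exists g.
Qed.

Lemma pe_Eval n s : RealisableFun n s -> Realisable n (fun a v => Eval (par n a) (s a) v).
Proof.
  intros Hs. destruct realise as [u Hu].
  eapply pe_mono. { apply (pe_run n (fun _ => u) s); [cf|exact Hs]. }
  intros a v. apply Hu.
Qed.

(** * Simulation of Kleene computations by the interpreter *)

Inductive Rep (f : nat -> nat) (fl : nat) : nat -> Obj -> Prop :=
| rep_num n : Rep f fl (sNum n) (onum n)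
| rep_clo e l g : (forall m, Eval f (pr (head 1 fl e l) m) (g m)) -> Rep f fl (sClo e l) (oF g)
| rep_OF : fl <> 0 -> b = true -> Rep f fl sOF (oF f)
| rep_OH : Rep f fl sOH (oH H)
| rep_O2 c F :
    (forall e l g, (forall m, Eval f (pr (head 1 fl e l) m) (g m)) ->
       Eval f (pr (head 0 fl c (enc [sClo e l; sOH])) 0) (F g)) ->
    Rep f fl (sO2 c) (existT T 2 F).

Lemma Rep_num f fl s x : Rep f fl s (onum x) -> s = sNum x.
Proof.
  intros h. inversion h as [n E Eo| | | |]; subst.
  apply (existT_T_inj 0) in Eo. now subst.
Qed.

Lemma Rep_low f fl s o : Rep f fl s o -> projT1 o <= 2.
Proof. destruct 1; simpl; lia. Qed.

Lemma Rep_fun2 f fl s (F : T 2) : Rep f fl s (existT T 2 F) ->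
  (s = sOH /\ F = H) \/
  exists c, s = sO2 c /\ forall e l g, (forall m, Eval f (pr (head 1 fl e l) m) (g m)) ->
       Eval f (pr (head 0 fl c (enc [sClo e l; sOH])) 0) (F g).
Proof.
  intros h. remember (existT T 2 F) as o eqn:Eo.
  destruct h as [n|e l g Hg|Hfl Eb| |c F' Hc]; try discriminate Eo.
  - left. split; auto. symmetry. exact (existT_T_inj 2 _ _ Eo).
  - right. exists c. split; auto. apply (existT_T_inj 2) in Eo. now subst.
Qed.

Lemma Forall2_firstn A B (R : A -> B -> Prop) l l' n :
  Forall2 R l l' -> Forall2 R (firstn n l) (firstn n l').
Proof. intros h. revert n. induction h; intros [|n]; simpl; auto. Qed.

Lemma Forall2_skipn A B (R : A -> B -> Prop) l l' n :
  Forall2 R l l' -> Forall2 R (skipn n l) (skipn n l').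
Proof. intros h. revert n. induction h; intros [|n]; simpl; auto. Qed.

Lemma Forall2_nth A B (R : A -> B -> Prop) l l' d d' n :
  Forall2 R l l' -> n < length l' -> R (nth n l d) (nth n l' d').
Proof.
  intros h. revert n. induction h; intros [|n] Hn; simpl in *; auto; try lia.
  apply IHh. lia.
Qed.

Lemma dec_tag e :
  match dec e with
  | S1 => p1 e = 0
  | S2 q => p1 e = 1 /\ p2 e = q
  | S3 => p1 e = 2
  | S4 i j => p1 e = 3 /\ p1 (p2 e) = i /\ p2 (p2 e) = j
  | S5 i j => p1 e = 4 /\ p1 (p2 e) = i /\ p2 (p2 e) = j
  | S6 i j => p1 e = 5 /\ p1 (p2 e) = i /\ p2 (p2 e) = j
  | S7 => p1 e = 6
  | S8 i => p1 e = 7 /\ p2 e = i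
  | S9 m => (exists k, p1 e = 8 + k) /\ p2 e = m
  end.
Proof.
  rewrite dec_eq. destruct (p1 e) as [|[|[|[|[|[|[|[|k]]]]]]]]; auto.
  split; [now exists k|reflexivity].
Qed.

Lemma nthK_1 s s' l : nthK 1 (consK s (consK s' l)) = s'.
Proof.
  change (nthK 1 (consK s (consK s' l))) with (hdK (tlK (consK s (consK s' l)))).
  now rewrite tlK_cons, hdK_cons.
Qed.

Ltac kle_step D E :=
  match type of D with dec ?e = _ =>
    pose proof (dec_tag e) as E; rewrite D in E;
    repeat match goal with h : _ /\ _ |- _ => destruct h end
  end.

Ltac kle_simpl :=
  unfold kle; cbv zeta;
  repeat match goal with h : p1 ?x = _ |- _ => rewrite h | h : p2 ?x = _ |- _ => rewrite h end;
  cbn [ifz Nat.sub]; rewrite ?hdK_cons, ?tlK_cons, ?nthK_1; unfold sNum, sClo, sOH, sOF, sO2;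
  repeat first [rewrite p1_pr | rewrite p2_pr]; cbn [ifz Nat.sub pred].

(** Objects with a code have type at most 2, so an S8 abstraction ranges over all numbers and
    becomes a single family of the interpreter. *)
Lemma simulation f fl e args v : K e args v ->
  forall L, Forall2 (Rep f fl) L args -> Eval f (pr (head 0 fl e (enc L)) 0) v.
Proof.
  intros C. induction C as
    [e x rest D|e q args D|e x rest D|e e1 e2 args m n D C2 IH2 C1 IH1
    |e e1 e2 rest n D C IH|e e1 e2 x rest m n D C1 IH1 C2 IH2
    |e i e1 args n D Hi C IH|e g x rest D|e e1 j F rest psi n D C IH En
    |e m a args n D Hm C IH]; intros L HL; kle_step D E.
  - inversion HL as [|s ? L' ? Hs HL']; subst. apply Rep_num in Hs as ->.
    apply Eval_rt. rewrite kd_0. cbn [enc]. kle_simpl. reflexivity.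
  - apply Eval_rt. rewrite kd_0. kle_simpl. now subst.
  - inversion HL as [|s ? L' ? Hs HL']; subst. apply Rep_num in Hs as ->.
    apply Eval_rt. rewrite kd_0. cbn [enc]. kle_simpl. reflexivity.
  - eapply Eval_st with (g := fun _ => m).
    + rewrite kd_0. kle_simpl. reflexivity.
    + intros w. apply (Eval_kd _ (pr (head 0 fl e2 (enc L)) 0)); auto. now rewrite !kd_0.
    + cbn. apply (Eval_mode1 _ _ _ _ _ 0). apply (IH1 (sNum m :: L)).
      constructor; auto using Rep.
  - inversion HL as [|s ? L' ? Hs HL']; subst. apply Rep_num in Hs as ->.
    eapply Eval_tail; [rewrite kd_0; cbn [enc]; kle_simpl; reflexivity|]. now apply IH.
  - inversion HL as [|s ? L' ? Hs HL']; subst. apply Rep_num in Hs as ->.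
    assert (HL2 : Forall2 (Rep f fl) (sNum x :: L') (onum x :: rest))
      by (constructor; auto using Rep).
    eapply Eval_st with (g := fun _ => m).
    + rewrite kd_0. cbn [enc]. kle_simpl. reflexivity.
    + intros w. apply (Eval_kd _ (pr (head 0 fl e (enc (sNum x :: L'))) 0)); auto.
      now rewrite !kd_0.
    + cbn [op ifz Nat.sub]. apply (Eval_mode1 _ _ _ _ _ 0). apply (IH2 (sNum m :: sNum x :: L')).
      constructor; auto using Rep.
  - assert (LL : length L = length args) by (now apply Forall2_length in HL).
    eapply Eval_tail; [rewrite kd_0; kle_simpl; reflexivity|].
    rewrite nthK_enc, skipK_enc, catK_enc by lia.
    apply (IH (nth i L 0 :: firstn i L ++ skipn (S i) L)). constructor.
    + now apply Forall2_nth.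
    + apply Forall2_app; [now apply Forall2_firstn|now apply Forall2_skipn].
  - inversion HL as [|s ? L1 ? Hs HL1]; subst.
    inversion HL1 as [|s2 ? L' ? Hs2 HL']; subst. apply Rep_num in Hs2 as ->.
    inversion Hs as [ |e' l g' Hg E1 Eo|Hfl Eb E1 Eo| |]; subst;
      apply (existT_T_inj 1) in Eo; subst.
    + eapply Eval_tail; [rewrite kd_0; cbn [enc]; kle_simpl; reflexivity|].
      apply (Eval_mode1 _ _ _ _ _ 0), Hg.
    + apply Eval_rt. rewrite kd_0. cbn [enc]. kle_simpl. f_equal.
      destruct fl; [easy|]. unfold ap. now rewrite Eb.
  - inversion HL as [|s ? L' ? Hs HL']; subst.
    pose proof (Rep_low _ _ _ _ Hs) as Hj. simpl in Hj. assert (j = 0) as -> by lia.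
    destruct (Rep_fun2 _ _ _ _ Hs) as [[-> ->]|[c [-> Hc]]].
    + eapply Eval_st with (g := psi).
      * rewrite kd_0. cbn [enc]. kle_simpl. reflexivity.
      * intros m. apply (Eval_mode1 _ _ _ _ _ 0).
        apply (IH m eq_refl (sNum m :: sOH :: L')). repeat (constructor; auto using Rep).
      * apply Eval_rt. now rewrite kd_2.
    + eapply Eval_st with (g := psi).
      * rewrite kd_0. cbn [enc]. kle_simpl. reflexivity.
      * intros m. apply (Eval_mode1 _ _ _ _ _ 0).
        apply (IH m eq_refl (sNum m :: sO2 c :: L')). repeat (constructor; auto using Rep).
      * apply (Eval_kd _ (pr (head 0 fl c (enc [sClo (p2 e) (enc (sO2 c :: L')); sOH])) 0));
          [now rewrite !kd_0|].
        apply Hc. intros m. apply (Eval_mode1 _ _ _ _ _ 0).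
        apply (IH m eq_refl (sNum m :: sO2 c :: L')). repeat (constructor; auto using Rep).
  - inversion HL as [|s ? L' ? Hs HL']; subst. apply Rep_num in Hs as ->.
    assert (LL : length L' = length args) by (now apply Forall2_length in HL').
    match goal with h : exists _, _ |- _ => destruct h as [k E] end.
    eapply Eval_tail; [rewrite kd_0; cbn [enc]; kle_simpl; reflexivity|].
    rewrite catK_enc_0 by lia. apply IH. now apply Forall2_firstn.
Qed.
Definition Lctx : list nat := if b then [sOF; sOH] else [sOH].

Lemma Rep_ctx f : Forall2 (Rep f 1) Lctx (ctx f).
Proof. unfold Lctx, ctx. destruct b eqn:Eb; repeat constructor; auto. Qed.

Definition fam1 (e : nat) : nat := head 1 1 e (enc Lctx).

Lemma Run_Eval f e x v : Run f e x v -> Eval f (pr (fam1 e) x) v.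
Proof.
  intros h. apply (Eval_mode1 _ _ _ _ _ 0).
  apply (simulation _ _ _ _ _ h (sNum x :: Lctx)). constructor; auto using Rep, Rep_ctx.
Qed.

Lemma Run_fun f e x v v' : Run f e x v -> Run f e x v' -> v = v'.
Proof. intros h h'. apply Run_Eval in h, h'. exact (Eval_fun _ _ _ h _ h'). Qed.

Fixpoint encenv (n : nat) : env n -> nat :=
  match n with
  | 0 => fun _ => enc Lctx
  | S k => fun a => consK (sNum (snd a)) (encenv k (fst a))
  end.

Lemma cf_encenv n : RealisableFun n (encenv n).
Proof.
  induction n as [|n IH]; simpl.
  - cf.
  - apply cf_consK; [cf|]. now apply cf_weak.
Qed.

Lemma encenv_spec n (a : env n) :
  exists L, encenv n a = enc L /\ Forall2 (Rep (par n a) 1) L (nums n a ++ ctx (par n a)).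
Proof.
  induction n as [|n IH]; simpl.
  - exists Lctx. split; auto. apply Rep_ctx.
  - destruct (IH (fst a)) as (L & EL & HL). exists (sNum (snd a) :: L). simpl.
    rewrite EL. split; auto. constructor; auto using Rep.
Qed.

(* The program of F receives g as a closure of the interpreter; this is Kleene's
   substitution theorem for type-1 arguments. *)
Lemma pe_F c (D : (nat -> nat) -> Prop) (F : T 2) n (R : env n -> nat -> nat -> Prop) :
  (forall g, D g -> K c [oF g; oH H] (F g)) ->
  Realisable (S n) (fun q v => R (fst q) (snd q) v) ->
  Realisable n (fun a v => exists g, (forall m, R a m (g m)) /\ D g /\ v = F g).
Proof.
  intros Hc [i Hi].
  eapply pe_mono.
  { apply (pe_Eval n (fun a => pr (head 0 1 c (consK (sClo i (encenv n a)) (enc [sOH]))) 0)).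
    pose proof (cf_encenv n). cf. }
  intros a v (g & Hg & Dg & ->).
  destruct (encenv_spec n a) as (L & EL & HL). rewrite EL.
  apply (simulation _ _ _ _ _ (Hc g Dg) [sClo i (enc L); sOH]).
  repeat constructor. intros m. apply (Eval_mode1 _ _ _ _ _ 0).
  assert (HK : K i (onum m :: nums n a ++ ctx (par n a)) (g m)).
  { specialize (Hi (a, m) (g m) [] (Hg m)). simpl in Hi. now rewrite app_nil_r in Hi. }
  apply (simulation _ _ _ _ _ HK (sNum m :: L)). constructor; auto using Rep.
Qed.

(** * Search for indices of total functions *)

Definition fam0 (d : nat) : nat := head 1 0 d (enc [sOH]).
(** The candidate [d] is run without the type-1 parameter, the test [i] with it. *)
Definition search (i x : nat) : nat := head 3 1 i (pr x (enc Lctx)).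

Lemma kd_3 f fl e l v : kd f (pr (head 3 fl e l) v) =
  st 1 (head 1 0 v (enc [sOH])) (head 4 fl e (consK (sNum (pr (p1 l) v)) (p2 l))).
Proof. kd_simpl. reflexivity. Qed.
Lemma kd_4 f fl e l v : kd f (pr (head 4 fl e l) v) = st 1 (head 0 fl e l) (head 5 fl 0 0).
Proof. kd_simpl. reflexivity. Qed.
Lemma kd_5 f fl e l v : kd f (pr (head 5 fl e l) v) =
  ifz v (rt 0) (st 1 (head 5 fl 0 0) (head 5 fl 0 0)).
Proof. kd_simpl. reflexivity. Qed.

Lemma kd_6 f fl e l v : kd f (pr (head 6 fl e l) v) =
  st 1 (head 0 fl e (consK (sNum (pr (p1 l) (pr (gnext fl e l) 0))) (p2 l))) (head 7 fl e l).
Proof. kd_simpl. reflexivity. Qed.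
Lemma kd_7_0 f fl e l : kd f (pr (head 7 fl e l) 0) =
  st 1 (head 9 fl (p2 (p1 l)) 0) (p1 (p1 l)).
Proof. kd_simpl. reflexivity. Qed.
Lemma kd_7_S f fl e l v : kd f (pr (head 7 fl e l) (S v)) =
  st 1 (gnext fl e l) (head 8 fl 0 0).
Proof. kd_simpl. reflexivity. Qed.
Lemma kd_8 f fl e l v : kd f (pr (head 8 fl e l) v) = rt (S v).
Proof. kd_simpl. reflexivity. Qed.
Lemma kd_9 f fl e l v : kd f (pr (head 9 fl e l) v) = rt e.
Proof. kd_simpl. reflexivity. Qed.

(** On a nonzero value, mode 5 demands a family to which the configuration itself belongs, so no
    well-founded evaluation exists. This is how the search diverges on a failed test. *)
Lemma Eval_5 f c v : Eval f c v -> forall fl w, c = pr (head 5 fl 0 0) w -> w = 0 /\ v = 0.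
Proof.
  induction 1 as [c E|c g v E Hg IHg Hk IHk]; intros fl w ->.
  - unfold kt, ka in *. rewrite kd_5 in *. unfold ifz, st, rt in *.
    destruct w; rewrite p1_pr in *; [|easy]. now rewrite p2_pr, p1_pr.
  - destruct w as [|w].
    + unfold kt in E. rewrite kd_5 in E. unfold ifz, rt in E. now rewrite p1_pr in E.
    + enough (S w = 0 /\ g (S w) = 0) by easy.
      apply (IHg (S w) fl). unfold ka. rewrite kd_5. unfold ifz, st.
      now rewrite p2_pr, p1_pr.
Qed.

Lemma search_inv f i x d v : Eval f (pr (search i x) d) v ->
  (exists g, forall m, Eval f (pr (fam0 d) m) (g m)) /\ Eval f (pr (fam1 i) (pr x d)) 0 /\ v = 0.
Proof.
  unfold search. intros h. eapply Eval_st_inv in h; [|apply kd_3]. destruct h as (g & Hg & hk).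
  split; [now exists g|].
  eapply Eval_st_inv in hk; [|apply kd_4]. destruct hk as (g' & Hg' & hk).
  rewrite p1_pr, p2_pr in Hg'.
  apply Eval_5 with (fl := 1) (w := op 2 g') in hk as [hk ->]; auto. split; auto.
  apply (Eval_mode1 _ _ _ _ _ 0). specialize (Hg' 0). cbn in hk. now rewrite hk in Hg'.
Qed.

Lemma search_halts f i x d g : (forall m, Eval f (pr (fam0 d) m) (g m)) ->
  Eval f (pr (fam1 i) (pr x d)) 0 -> Eval f (pr (search i x) d) 0.
Proof.
  intros Hg h0. eapply Eval_st with (g := g); [apply kd_3|exact Hg|].
  eapply Eval_st with (g := fun _ => 0).
  - apply kd_4.
  - intros w. rewrite p1_pr, p2_pr. now apply Eval_mode1.
  - apply Eval_rt. now rewrite kd_5.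
Qed.

(** * Number quantifiers from normality *)

Variable normH : normal H.

Definition Ex (f : nat -> nat) : nat :=
  if excluded_middle_informative (exists m, f m = 0) then 0 else 1.

Lemma Ex_0 f : Ex f = 0 <-> exists m, f m = 0.
Proof. unfold Ex. destruct excluded_middle_informative; split; auto; easy. Qed.

Lemma Ex_index : exists c, forall g, True -> K c [oF g; oH H] (Ex g).
Proof.
  destruct normH as [c Hc]. exists c. intros g _. destruct (Hc g) as (n & h & h0 & h1).
  replace (Ex g) with n; auto. unfold Ex.
  destruct excluded_middle_informative as [E|E]; destruct h1; subst; auto; exfalso.
  - now apply h0 in E.
  - now apply E, h0.
Qed.

Lemma pe_Ex n (R : env n -> nat -> nat -> Prop) :
  Realisable (S n) (fun q v => R (fst q) (snd q) v) ->
  Realisable n (fun a v => rAp Ex (R a) v).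
Proof.
  intros HR. destruct Ex_index as [c Hc].
  eapply pe_mono. { apply (pe_F c _ Ex n R Hc HR). }
  intros a v (g & Hg & ->). eauto.
Qed.

Lemma cf_Ex n (s : env n -> nat -> nat) :
  RealisableFun (S n) (fun q => s (fst q) (snd q)) -> RealisableFun n (fun a => Ex (s a)).
Proof.
  intros Hs. eapply pe_mono. { apply (pe_Ex n (fun a m v => v = s a m) Hs). }
  intros a v ->. now exists (s a).
Qed.
Definition All (g : nat -> nat) : nat := ifz (Ex (fun m => ifz (g m) 1 0)) 1 0.

Lemma All_0 g : All g = 0 <-> forall m, g m = 0.
Proof.
  unfold All. destruct (Ex _) eqn:E; cbn [ifz].
  - apply Ex_0 in E as [m E]. split; [easy|]. intros h. now rewrite h in E.
  - split; auto. intros _ m. destruct (g m) eqn:Em; auto.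
    assert (Ex (fun m => ifz (g m) 1 0) = 0) by (apply Ex_0; exists m; now rewrite Em).
    congruence.
Qed.

Lemma pe_All n (R : env n -> nat -> nat -> Prop) :
  Realisable (S n) (fun q v => R (fst q) (snd q) v) -> Realisable n (fun a v => rAp All (R a) v).
Proof.
  intros HR.
  apply pe_mono with (R := fun a v => rLet
    (rAp Ex (fun m => rLet (R a m) (fun w v => v = ifz w 1 0))) (fun w v => v = ifz w 1 0) v).
  - apply pe_let; [apply (pe_Ex n (fun a m => rLet (R a m) (fun w v => v = ifz w 1 0)))|pe].
    apply (pe_let (S n) (fun q => R (fst q) (snd q))); [exact HR|pe].
  - intros a v (g & Hg & ->). exists (Ex (fun m => ifz (g m) 1 0)). split; auto.
    exists (fun m => ifz (g m) 1 0). split; auto. intros m. now exists (g m).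
Qed.

Definition opU (f : nat -> nat) (c : nat) : nat -> Prop :=
  rIf (kt f c - 1) (rAp H (fun m => Eval f (pr (ka f c) m))) (Eval f (pr (ka f c) 0)).

Lemma pe_opU n s : RealisableFun n s -> Realisable n (fun a v => opU (par n a) (s a) v).
Proof.
  intros Hs. unfold opU. pose proof (cf_weak _ _ Hs).
  apply (pe_if n (fun a => kt (par n a) (s a) - 1)).
  - cf.
  - apply (pe_H n (fun a m => Eval (par n a) (pr (ka (par n a) (s a)) m))).
    apply (pe_Eval (S n)). apply cf_pr; [|cf].
    apply (cf_weak n (fun a => ka (par n a) (s a))). cf.
  - apply pe_Eval. cf.
Qed.

Lemma opU_intro f c g : (forall m, Eval f (pr (ka f c) m) (g m)) -> opU f c (op (kt f c) g).
Proof.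
  intros hg. unfold opU, op, rIf. destruct (kt f c - 1); [left|right]; simpl; auto.
  split; auto. now exists g.
Qed.

Ltac pe_hook ::=
  lazymatch goal with
  | |- Realisable ?n (fun a v => rAp Ex (@?R a) v) => apply (pe_Ex n R); pe
  | |- Realisable ?n (fun a v => rAp All (@?R a) v) => apply (pe_All n R); pe
  | |- Realisable ?n (fun a v => Eval _ (@?s a) v) => apply (pe_Eval n s); cf
  | |- Realisable ?n (fun a v => opU _ (@?s a) v) => apply (pe_opU n s); cf
  end.

(** * Comparison and Gandy selection *)

(** Result 0 claims that [c] halts, a nonzero result that [d] does. If every branch of [c] wins
    against some branch of [d], the family of [c] halts throughout; otherwise one branch of [c]
    loses to all branches of [d], and the family of [d] halts. The completed family yields a
    continuation, which is compared with the branches of the other side. *)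
Definition cmpB (f : nat -> nat) (z c d : nat) : nat -> Prop :=
  rIf (kt f c) (fun v => v = 0)
  (rIf (kt f d) (fun v => v = 1)
  (rLet (rAp All (fun m => rAp Ex (fun n => Run f z (pr z (pr (pr (ka f c) m) (pr (ka f d) n))))))
  (fun q => rIf q
    (rLet (opU f c) (fun w =>
      rLet (rAp Ex (fun n => Run f z (pr z (pr (pr (kb f c) w) (pr (ka f d) n))))) (fun r =>
        rIf r (fun v => v = 0)
          (rLet (opU f d) (fun w' => Run f z (pr z (pr (pr (kb f c) w) (pr (kb f d) w'))))))))
    (rLet (opU f d) (fun w' =>
      rLet (rAp All (fun m => Run f z (pr z (pr (pr (ka f c) m) (pr (kb f d) w'))))) (fun r =>
        rIf r
          (rLet (opU f c) (fun w => Run f z (pr z (pr (pr (kb f c) w) (pr (kb f d) w')))))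
          (fun v => v = 1))))))).

Lemma pe_cmpB :
  Realisable 1 (fun q v => cmpB (fst q) (p1 (snd q)) (p1 (p2 (snd q))) (p2 (p2 (snd q))) v).
Proof. unfold cmpB. pe. Qed.

Definition halts f c := exists v, Eval f c v.

Lemma dep_choice (P : nat -> nat -> Prop) : (forall m, exists v, P m v) ->
  exists g, forall m, P m (g m).
Proof.
  intros h. exists (fun m => proj1_sig (constructive_indefinite_description _ (h m))).
  intros m. apply proj2_sig.
Qed.

Lemma halts_step f c g : kt f c <> 0 -> (forall m, Eval f (pr (ka f c) m) (g m)) ->
  halts f (pr (kb f c) (op (kt f c) g)) -> halts f c.
Proof. intros E hg [v h]. exists v. now apply Eval_step with g. Qed.

Section Cmp.
Variables (f : nat -> nat) (z : nat).
Hypothesis Hz : forall x v,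
  cmpB f (p1 x) (p1 (p2 x)) (p2 (p2 x)) v -> Run f z x v.

Definition cmp_ok (c d : nat) : Prop :=
  exists r, Run f z (pr z (pr c d)) r /\ (r = 0 -> halts f c) /\ (r <> 0 -> halts f d).

Lemma cmp_intro c d v : cmpB f z c d v -> Run f z (pr z (pr c d)) v.
Proof. intros h. apply Hz. now rewrite !p2_pr, !p1_pr. Qed.

Lemma cmp_choice (C D : nat -> nat) : (forall n, cmp_ok (C n) (D n)) ->
  exists t, forall n, Run f z (pr z (pr (C n) (D n))) (t n) /\
    (t n = 0 -> halts f (C n)) /\ (t n <> 0 -> halts f (D n)).
Proof.
  apply (dep_choice (fun n r => Run f z (pr z (pr (C n) (D n))) r /\
    (r = 0 -> halts f (C n)) /\ (r <> 0 -> halts f (D n)))).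
Qed.

(* c and d are stepped in parallel, so it suffices that one of them halts. *)
Lemma cmp_step c d : kt f c <> 0 -> kt f d <> 0 ->
  (forall m n, cmp_ok (pr (ka f c) m) (pr (ka f d) n)) ->
  (forall g n, (forall m, Eval f (pr (ka f c) m) (g m)) ->
     cmp_ok (pr (kb f c) (op (kt f c) g)) (pr (ka f d) n)) ->
  (forall g m, (forall n, Eval f (pr (ka f d) n) (g n)) ->
     cmp_ok (pr (ka f c) m) (pr (kb f d) (op (kt f d) g))) ->
  (forall g g', (forall m, Eval f (pr (ka f c) m) (g m)) ->
     (forall m, Eval f (pr (ka f d) m) (g' m)) ->
     cmp_ok (pr (kb f c) (op (kt f c) g)) (pr (kb f d) (op (kt f d) g'))) ->
  cmp_ok c d.
Proof.
  intros Ec Ed Haa Hka Hak Hkk.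
  assert (Hc : forall v, cmpB f z c d v -> (v = 0 -> halts f c) -> (v <> 0 -> halts f d) ->
    cmp_ok c d).
  { intros v h. exists v. split; auto. now apply cmp_intro. }
  assert (exists tab, forall m n, Run f z (pr z (pr (pr (ka f c) m) (pr (ka f d) n))) (tab m n)
     /\ (tab m n = 0 -> halts f (pr (ka f c) m)) /\ (tab m n <> 0 -> halts f (pr (ka f d) n)))
    as [tab Htab].
  { exists (fun m n => proj1_sig (constructive_indefinite_description _ (Haa m n))).
    intros m n. exact (proj2_sig (constructive_indefinite_description _ (Haa m n))). }
  set (q := All (fun m => Ex (tab m))).
  assert (Hq : rAp All (fun m => rAp Ex (fun n =>
     Run f z (pr z (pr (pr (ka f c) m) (pr (ka f d) n))))) q).
  { exists (fun m => Ex (tab m)). split; auto. intros m. exists (tab m). split; auto.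
    intros n. apply Htab. }
  destruct (Nat.eq_dec q 0) as [Eq|Eq].
  - assert (exists g, forall m, Eval f (pr (ka f c) m) (g m)) as [g Hg].
    { apply (dep_choice (fun m v => Eval f (pr (ka f c) m) v)). intros m. unfold q in Eq.
      rewrite All_0 in Eq.
      specialize (Eq m). apply Ex_0 in Eq as [n Eq]. now apply (Htab m n). }
    assert (exists t, forall n,
      Run f z (pr z (pr (pr (kb f c) (op (kt f c) g)) (pr (ka f d) n))) (t n) /\
      (t n = 0 -> halts f (pr (kb f c) (op (kt f c) g))) /\
      (t n <> 0 -> halts f (pr (ka f d) n))) as [t Ht].
    { apply (cmp_choice (fun _ => _) (fun n => pr (ka f d) n)). intros n. now apply Hka. }
    destruct (Nat.eq_dec (Ex t) 0) as [Et|Et].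
    + apply (Hc 0); [|intros _|easy].
      * right. split; auto. right. split; auto. exists q. split; auto. left. split; auto.
        exists (op (kt f c) g). split; [now apply opU_intro|].
        exists (Ex t). split; [|now left]. exists t. split; auto. intros n. apply Ht.
      * apply (halts_step _ _ g); auto. apply Ex_0 in Et as [n Et]. now apply (Ht n).
    + assert (exists g', forall m, Eval f (pr (ka f d) m) (g' m)) as [g' Hg'].
      { apply (dep_choice (fun m v => Eval f (pr (ka f d) m) v)). intros n. apply (Ht n).
        contradict Et. apply Ex_0. now exists n. }
      destruct (Hkk g g' Hg Hg') as (r & Hr & Hr0 & Hr1).
      apply (Hc r).
      * right. split; auto. right. split; auto. exists q. split; auto. left. split; auto.
        exists (op (kt f c) g). split; [now apply opU_intro|].
        exists (Ex t). split. { exists t. split; auto. intros n. apply Ht. }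
        right. split; auto. exists (op (kt f d) g'). split; [now apply opU_intro|auto].
      * intros Er. apply (halts_step _ _ g); auto.
      * intros Er. apply (halts_step _ _ g'); auto.
  - assert (exists g', forall n, Eval f (pr (ka f d) n) (g' n)) as [g' Hg'].
    { apply (dep_choice (fun m v => Eval f (pr (ka f d) m) v)). intros n. unfold q in Eq.
      rewrite All_0 in Eq.
      apply not_all_ex_not in Eq as [m Eq]. rewrite Ex_0 in Eq.
      apply (Htab m n). contradict Eq. now exists n. }
    assert (exists t, forall m,
      Run f z (pr z (pr (pr (ka f c) m) (pr (kb f d) (op (kt f d) g')))) (t m) /\
      (t m = 0 -> halts f (pr (ka f c) m)) /\
      (t m <> 0 -> halts f (pr (kb f d) (op (kt f d) g')))) as [t Ht].
    { apply (cmp_choice (fun m => pr (ka f c) m) (fun _ => _)). intros n. now apply Hak. }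
    assert (HrT : rAp All (fun m =>
      Run f z (pr z (pr (pr (ka f c) m) (pr (kb f d) (op (kt f d) g'))))) (All t)).
    { exists t. split; auto. intros m. apply Ht. }
    destruct (Nat.eq_dec (All t) 0) as [Et|Et].
    + assert (exists g, forall m, Eval f (pr (ka f c) m) (g m)) as [g Hg].
      { apply (dep_choice (fun m v => Eval f (pr (ka f c) m) v)). intros m. apply (Ht m).
        revert m. now apply All_0. }
      destruct (Hkk g g' Hg Hg') as (r & Hr & Hr0 & Hr1).
      apply (Hc r).
      * right. split; auto. right. split; auto. exists q. split; auto. right. split; auto.
        exists (op (kt f d) g'). split; [now apply opU_intro|].
        exists (All t). split; auto. left. split; auto.
        exists (op (kt f c) g). split; [now apply opU_intro|auto].
      * intros Er. apply (halts_step _ _ g); auto.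
      * intros Er. apply (halts_step _ _ g'); auto.
    + apply (Hc 1); [|easy|intros _].
      * right. split; auto. right. split; auto. exists q. split; auto. right. split; auto.
        exists (op (kt f d) g'). split; [now apply opU_intro|].
        exists (All t). split; auto. right. split; auto.
      * apply (halts_step _ _ g'); auto. rewrite All_0 in Et.
        apply not_all_ex_not in Et as [m Et]. now apply (Ht m).
Qed.

Lemma cmp_ret_l c d : kt f c = 0 -> cmp_ok c d.
Proof.
  intros Ec. exists 0. split; [|split; [intros _|easy]].
  - apply cmp_intro. now left.
  - exists (ka f c). now apply Eval_ret.
Qed.

Lemma cmp_ret_r c d : kt f d = 0 -> cmp_ok c d.
Proof.
  intros Ed. destruct (Nat.eq_dec (kt f c) 0) as [Ec|Ec]; [now apply cmp_ret_l|].
  exists 1. split; [|split; [easy|intros _]].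
  - apply cmp_intro. right. split; auto. now left.
  - exists (ka f d). now apply Eval_ret.
Qed.

(** Each comparison required by [cmp_step] has a branch or the continuation of [c] on its left,
    where the induction hypothesis holds against arbitrary opponents. Determinism identifies any
    family of values with the given one. *)
Lemma cmp_l c : halts f c -> forall d, cmp_ok c d.
Proof.
  intros [v h]. induction h as [c E|c g v E Hg IHg Hk IHk]; intros d.
  - now apply cmp_ret_l.
  - destruct (Nat.eq_dec (kt f d) 0) as [Ed|Ed]; [now apply cmp_ret_r|].
    assert (Hgg : forall g', (forall m, Eval f (pr (ka f c) m) (g' m)) -> g' = g).
    { intros g' Hg'. extensionality m. exact (Eval_fun _ _ _ (Hg' m) _ (Hg m)). }
    apply cmp_step; auto.
    + intros g' n Hg'. rewrite (Hgg g' Hg'). auto.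
    + intros g' g'' Hg' _. rewrite (Hgg g' Hg'). auto.
Qed.

Lemma cmp_r d : halts f d -> forall c, cmp_ok c d.
Proof.
  intros [v h]. induction h as [d E|d g v E Hg IHg Hk IHk]; intros c.
  - now apply cmp_ret_r.
  - destruct (Nat.eq_dec (kt f c) 0) as [Ec|Ec]; [now apply cmp_ret_l|].
    assert (Hgg : forall g', (forall m, Eval f (pr (ka f d) m) (g' m)) -> g' = g).
    { intros g' Hg'. extensionality m. exact (Eval_fun _ _ _ (Hg' m) _ (Hg m)). }
    apply cmp_step; auto.
    + intros g' n Hg'. rewrite (Hgg g' Hg'). auto.
    + intros g' g'' _ Hg'. rewrite (Hgg g'' Hg'). auto.
Qed.

End Cmp.

Lemma comparison : exists z, forall f c d, halts f c \/ halts f d ->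
  exists r, Run f z (pr c d) r /\ (r = 0 -> halts f c) /\ (r <> 0 -> halts f d).
Proof.
  destruct (pe_index _ pe_cmpB) as [z Hz].
  destruct (pe_index (fun q v => Run (fst q) z (pr z (snd q)) v)) as [u Hu]; [pe|].
  exists u. intros f c d h.
  assert (cmp_ok f z c d) as (r & Hr & h0 & h1).
  { destruct h; [apply cmp_l|apply cmp_r]; auto; intros x v; apply Hz. }
  exists r. split; [now apply (Hu f)|auto].
Qed.

Definition gconf (cmp s k : nat) : nat := pr (head 6 1 cmp (pr (pr s k) (enc Lctx))) 0.

(* gconf k runs the family at k, or else is 1 + gconf (k + 1), according to
   which of the two the comparison sees halting. *)
Lemma gconf_inv f cmp s k v : Eval f (gconf cmp s k) v ->
  Eval f (pr s k) v \/ exists j, v = S j /\ Eval f (gconf cmp s (S k)) j.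
Proof.
  intros h. eapply Eval_st_inv in h; [|apply kd_6]. destruct h as (g & _ & h).
  set (r := op 2 g) in h. destruct r as [|r].
  - left. eapply Eval_st_inv in h; [|apply kd_7_0]. destruct h as (g' & Hg' & h).
    rewrite !p1_pr, !p2_pr in *. specialize (Hg' 0). eapply Eval_rt_inv in Hg'; [|apply kd_9].
    cbn in h. now rewrite Hg' in h.
  - right. eapply Eval_st_inv in h; [|apply kd_7_S]. destruct h as (g' & Hg' & h).
    specialize (Hg' 0). eapply Eval_rt_inv in h; [|apply kd_8].
    exists (g' 0). split; auto. unfold gnext in Hg'. now rewrite !p1_pr, !p2_pr in Hg'.
Qed.

Lemma gconf_halts f cmp s k :
  (forall c d, halts f c \/ halts f d ->
    exists r, Run f cmp (pr c d) r /\ (r = 0 -> halts f c) /\ (r <> 0 -> halts f d)) ->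
  halts f (pr s k) \/ halts f (gconf cmp s (S k)) -> halts f (gconf cmp s k).
Proof.
  intros Hcmp h. destruct (Hcmp _ _ h) as (r & Hr & h0 & h1).
  assert (exists v, Eval f (pr (head 7 1 cmp (pr (pr s k) (enc Lctx))) r) v) as [v hv].
  { destruct r as [|r].
    - destruct (h0 eq_refl) as [v hv]. exists v.
      eapply Eval_st with (g := fun _ => k); [apply kd_7_0| |].
      + intros m. apply Eval_rt. now rewrite kd_9, p1_pr, p2_pr.
      + change (op 2 (fun _ => k)) with k. now rewrite !p1_pr.
    - destruct (h1 (Nat.neq_succ_0 r)) as [v hv]. exists (S v).
      eapply Eval_st with (g := fun _ => v); [apply kd_7_S| |].
      + intros m. unfold gnext. rewrite !p1_pr, !p2_pr.
        eapply Eval_kd; [|exact hv]. unfold gconf. now rewrite !kd_6.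
      + apply Eval_rt. now rewrite kd_8. }
  exists v. eapply Eval_st with (g := fun _ => r); [apply kd_6| |exact hv].
  intros m. rewrite p1_pr, p2_pr. apply Eval_mode1. unfold gnext. rewrite !p1_pr, !p2_pr.
  exact (Run_Eval _ _ _ _ Hr).
Qed.

(** Halting of [gconf] descends from a witness [k0] to 0. Conversely, a value [d] at 0 unwinds into
    [d] refusals and one acceptance: [search] returns nothing but 0, so the value counts the
    refusals and is itself the selected number. *)
Lemma gandy_selection i : exists nu, forall f x, (exists d, halts f (pr (search i x) d)) ->
  exists d, Run f nu x d /\ halts f (pr (search i x) d).
Proof.
  destruct comparison as [cmp Hcmp].
  destruct (pe_index (fun q v => Eval (fst q) (gconf cmp (search i (snd q)) 0) v)) as [nu Hnu].
  { unfold gconf, search. pe. }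
  exists nu. intros f x [k0 Hk0].
  assert (h : forall n k, n + k = k0 -> halts f (gconf cmp (search i x) k)).
  { induction n as [|n IH]; intros k Hk; apply gconf_halts; auto.
    - left. simpl in Hk. now subst.
    - right. apply IH. lia. }
  destruct (h k0 0 (Nat.add_0_r _)) as [d Hd]. exists d. split; [now apply Hnu|].
  enough (sp : forall d k, Eval f (gconf cmp (search i x) k) d ->
  halts f (pr (search i x) (k + d)))
    by exact (sp d 0 Hd).
  clear d Hd. induction d as [|d IH]; intros k Hd.
  - rewrite Nat.add_0_r. apply gconf_inv in Hd as [Hd|(j & E & _)]; [|easy]. now exists 0.
  - apply gconf_inv in Hd as [Hd|(j & [= <-] & Hd)].
    + apply search_inv in Hd. easy.
    + rewrite <- Nat.add_succ_comm. now apply IH.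
Qed.

(** * Selection of indices with a decidable property *)

Definition Tot (f : nat -> nat) (d : nat) : Prop :=
  exists g, forall m, Eval f (pr (fam0 d) m) (g m).

(** That the realising index returns 0 at [d] does not by itself give [R], as only one direction is
    known. The second hypothesis provides some value of [R] at [d], and determinism makes it 0. *)
Lemma select (R : env 1 -> nat -> Prop) : Realisable 1 R ->
  exists nu, forall f x, (exists d, Tot f d /\ R (f, pr x d) 0) ->
    (forall d, Tot f d -> exists v, R (f, pr x d) v) ->
    exists d, Run f nu x d /\ Tot f d /\ R (f, pr x d) 0.
Proof.
  intros HR. destruct (pe_index R HR) as [i Hi]. destruct (gandy_selection i) as [nu Hnu].
  exists nu. intros f x (d0 & [g Hg] & Hd0) Htot.
  destruct (Hnu f x) as (d & Hd & [v Hs]).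
  - exists d0, 0. apply search_halts with g; auto. now apply Run_Eval, Hi.
  - exists d. apply search_inv in Hs as (Ht & h0 & _). split; auto. split; auto.
    destruct (Htot d Ht) as [w Hw]. pose proof (Run_Eval _ _ _ _ (Hi _ _ _ Hw)) as h1.
    now rewrite (Eval_fun _ _ _ h0 _ h1).
Qed.

Definition dist (x y : nat) : nat := (x - y) + (y - x).

Lemma dist_0 x y : dist x y = 0 <-> x = y.
Proof. unfold dist. lia. Qed.

Lemma cf_All n (s : env n -> nat -> nat) :
  RealisableFun (S n) (fun q => s (fst q) (snd q)) -> RealisableFun n (fun a => All (s a)).
Proof.
  intros Hs. eapply pe_mono. { apply (pe_All n (fun a m v => v = s a m) Hs). }
  intros a v ->. now exists (s a).
Qed.

(** Phrased by substitution, so that the tactic [cf] can treat [Y] as one more function symbol in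
    any environment. *)
Definition computable (Y : nat -> nat) : Prop :=
  forall n s, RealisableFun n s -> RealisableFun n (fun a => Y (s a)).

Lemma computable_fam0 d Y :
  (forall f m, Eval f (pr (fam0 d) m) (Y m)) -> computable Y.
Proof.
  intros h n s Hs. eapply pe_mono.
  { apply (pe_Eval n (fun a => pr (fam0 d) (s a))). unfold fam0. cf. }
  intros a v ->. apply h.
Qed.

Ltac cf_hook ::=
  lazymatch goal with
  | |- RealisableFun ?n (fun a => kt _ (@?s a)) => apply (cf_kt n s); cf
  | |- RealisableFun ?n (fun a => ka _ (@?s a)) => apply (cf_ka n s); cf
  | |- RealisableFun ?n (fun a => kb _ (@?s a)) => apply (cf_kb n s); cf
  | |- RealisableFun ?n (fun a => dist (@?s a) (@?t a)) => unfold dist; cf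
  | |- RealisableFun ?n (fun a => Ex (@?s a)) => apply (cf_Ex n s); cbv beta; cf
  | |- RealisableFun ?n (fun a => All (@?s a)) => apply (cf_All n s); cbv beta; cf
  | |- RealisableFun ?n (fun a => prec (@?z a) (@?s a) (@?t a)) => apply (cf_prec n z s t); cbv beta; cf
  | h : computable ?Y |- RealisableFun ?n (fun a => ?Y (@?s a)) => apply (h n s); cf
  end.

(** * Cluster points *)

Section Cluster.
Variable Y : nat -> nat.
Hypotheses (CY : computable Y) (BY : forall n j, Y (pr n j) <= 1).

(* A code [c] of the list of the first [i] bits, the last one first. *)
Definition agree (n i c : nat) : nat :=
  All (fun j => ifz (S j - i) (dist (Y (pr n j)) (nthK (i - S j) c)) 0).
Definition infinite (i c : nat) : nat := All (fun k => Ex (fun n => (k - n) + agree n i c)).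
Definition leftmost (i : nat) : nat :=
  prec 0 (fun i c => consK (ifz (infinite (S i) (consK 0 c)) 0 1) c) i.
Definition limit (i : nat) : nat := hdK (leftmost (S i)).

Lemma cf_limit : RealisableFun 1 (fun q => limit (snd q)).
Proof. unfold limit, leftmost, infinite, agree. cf. Qed.

Lemma agree_0 n i c : agree n i c = 0 <-> forall j, j < i -> Y (pr n j) = nthK (i - S j) c.
Proof.
  unfold agree. rewrite All_0. split; intros h j.
  - intros Hj. specialize (h j). replace (S j - i) with 0 in h by lia. now apply dist_0.
  - destruct (S j - i) eqn:E; simpl; auto. apply dist_0, h. lia.
Qed.

Lemma infinite_0 i c : infinite i c = 0 <-> forall k, exists n, k <= n /\ agree n i c = 0.
Proof.
  unfold infinite. rewrite All_0. split; intros h k; specialize (h k).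
  - apply Ex_0 in h as [n Hn]. exists n. lia.
  - apply Ex_0. destruct h as [n Hn]. exists n. lia.
Qed.

Lemma nthK_S k s l : nthK (S k) (consK s l) = nthK k l.
Proof.
  unfold nthK. f_equal. induction k as [|k IH]; [apply tlK_cons|].
  change (tlK (skipK (S k) (consK s l)) = tlK (skipK k l)). now rewrite IH.
Qed.

Lemma leftmost_S i : leftmost (S i) = consK (limit i) (leftmost i).
Proof. unfold limit, leftmost. rewrite prec_S. now rewrite hdK_cons. Qed.

Lemma limit_eq i : limit i = ifz (infinite (S i) (consK 0 (leftmost i))) 0 1.
Proof. unfold limit, leftmost. rewrite prec_S. now rewrite hdK_cons. Qed.

Lemma nthK_leftmost i j : j < i -> nthK (i - S j) (leftmost i) = limit j.
Proof.
  induction i as [|i IH]; intros Hj; [lia|]. rewrite leftmost_S.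
  destruct (Nat.eq_dec j i) as [->|Ne].
  - rewrite Nat.sub_diag. apply hdK_cons.
  - replace (S i - S j) with (S (i - S j)) by lia. rewrite nthK_S. apply IH. lia.
Qed.

Lemma agree_cons n i x c : agree n i c = 0 -> Y (pr n i) = x -> agree n (S i) (consK x c) = 0.
Proof.
  rewrite !agree_0. intros h hx j Hj. destruct (Nat.eq_dec j i) as [->|Ne].
  - rewrite Nat.sub_diag, hx. symmetry. apply hdK_cons.
  - replace (S i - S j) with (S (i - S j)) by lia. rewrite nthK_S. apply h. lia.
Qed.

(** König's argument: a prefix met by rows of arbitrarily large number has an extension by one bit
    with the same property, and 0 is tried before 1. *)
Lemma infinite_leftmost i : infinite i (leftmost i) = 0.
Proof.
  induction i as [|i IH].
  - apply infinite_0. intros k. exists k. split; auto. apply agree_0. lia.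
  - rewrite leftmost_S, limit_eq. destruct (infinite (S i) (consK 0 (leftmost i))) eqn:E; auto.
    apply infinite_0. intros k. simpl.
    assert (h : ~ infinite (S i) (consK 0 (leftmost i)) = 0) by lia.
    rewrite infinite_0 in h. apply not_all_ex_not in h as [k0 h].
    (* From [k0] on no row agrees with the extension by 0, so a row beyond [k + k0] that agrees up
       to [i] continues with 1. *)
    rewrite infinite_0 in IH. destruct (IH (k + k0)) as (n' & Hn & Ha).
    exists n'. split; [lia|]. apply agree_cons; auto.
    pose proof (BY n' i). destruct (Nat.eq_dec (Y (pr n' i)) 0) as [E0|E0]; [|lia].
    exfalso. apply h. exists n'. split; [lia|]. now apply agree_cons.
Qed.

Lemma limit_spec i k : exists n, k <= n /\ forall j, j < i -> Y (pr n j) = limit j.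
Proof.
  pose proof (infinite_leftmost i) as h. rewrite infinite_0 in h.
  destruct (h k) as (n & Hn & Ha). exists n. split; auto. intros j Hj.
  rewrite agree_0 in Ha. rewrite Ha by auto. now apply nthK_leftmost.
Qed.

Lemma limit_binary i : limit i <= 1.
Proof. rewrite limit_eq. destruct (infinite _ _); simpl; lia. Qed.

End Cluster.

(** * Subcomputations *)

Inductive Reach (f : nat -> nat) : nat -> nat -> Prop :=
| reach_refl c : Reach f c c
| reach_a c m s : kt f c <> 0 -> Reach f (pr (ka f c) m) s -> Reach f c s
| reach_b c g s : kt f c <> 0 -> (forall m, Eval f (pr (ka f c) m) (g m)) ->
    Reach f (pr (kb f c) (op (kt f c) g)) s -> Reach f c s.

Lemma reach_halts f c s : Reach f c s -> halts f c -> halts f s.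
Proof.
  induction 1 as [c|c m s E h IH|c g s E Hg h IH]; auto; intros [v Hc]; apply IH;
    inversion Hc as [c' E'|c' g' v' E' Hg' Hk']; subst; try easy.
  - now exists (g' m).
  - exists v.
  now replace g with g' by (extensionality m; apply (Eval_fun _ _ _ (Hg' m) _ (Hg m))).
Qed.

(** A path [p] codes choices: 0 stops, a head [S m] enters branch [m] of the family, a head 0 enters
    the continuation. A returning configuration absorbs the rest of the path, which makes the
    enumeration total. *)
Definition pathB (f : nat -> nat) (z c p : nat) : nat -> Prop :=
  rIf p (fun v => v = c)
  (rIf (kt f c) (fun v => v = c)
  (rIf (p1 (pred p))
    (rLet (opU f c) (fun w => Run f z (pr z (pr (pr (kb f c) w) (p2 (pred p))))))
    (Run f z (pr z (pr (pr (ka f c) (pred (p1 (pred p)))) (p2 (pred p))))))).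

Lemma paths : exists u, forall f c, halts f c ->
  (forall p, exists s, Run f u (pr c p) s /\ Reach f c s) /\
  (forall s, Reach f c s -> exists p, Run f u (pr c p) s).
Proof.
  destruct (pe_index (fun q v =>
    pathB (fst q) (p1 (snd q)) (p1 (p2 (snd q))) (p2 (p2 (snd q))) v)) as [z Hz].
  { unfold pathB. pe. }
  destruct (pe_index (fun q v => Run (fst q) z (pr z (snd q)) v)) as [u Hu]; [pe|].
  exists u. intros f c hc.
  assert (HB : forall c p v, pathB f z c p v -> Run f z (pr z (pr c p)) v).
  { intros c' p v h. apply Hz. simpl. now rewrite !p2_pr, !p1_pr. }
  split.
  - enough (h : forall p, exists s, Run f z (pr z (pr c p)) s /\ Reach f c s).
    { intros p. destruct (h p) as (s & Hs & Hr). exists s.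
      split; [now apply (Hu f (pr c p))|auto]. }
    destruct hc as [v hc].
    induction hc as [c E|c g v E Hg IHg Hk IHk]; intros p.
    + exists c. split; [|constructor]. apply HB. destruct p; [now left|].
      right. split; auto. now left.
    + destruct p as [|p]; [exists c; split; [apply HB; now left|constructor]|].
      destruct (p1 p) as [|m] eqn:Em.
      * destruct (IHk (p2 p)) as (s & Hs & Hr). exists s. split; [|now apply reach_b with g].
        apply HB. right. split; auto. right. split; auto. left. simpl. split; auto.
        exists (op (kt f c) g). split; auto. now apply opU_intro.
      * destruct (IHg m (p2 p)) as (s & Hs & Hr). exists s. split; [|now apply reach_a with m].
        apply HB. right. split; auto. right. split; auto. right. simpl. rewrite Em. auto.
  - intros s hr. enough (exists p, Run f z (pr z (pr c p)) s) as [p Hp].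
    { exists p. now apply (Hu f (pr c p)). }
    clear hc. induction hr as [c|c m s E h [p IH]|c g s E Hg h [p IH]].
    + exists 0. apply HB. now left.
    + exists (S (pr (S m) p)). apply HB. right. split; auto. right. split; auto. right.
      cbn [pred]. rewrite p1_pr, p2_pr. auto.
    + exists (S (pr 0 p)). apply HB. right. split; auto. right. split; auto. left.
      cbn [pred]. rewrite p1_pr, p2_pr. split; auto.
      exists (op (kt f c) g). split; auto. now apply opU_intro.
Qed.

(** Behind a prefix of length [L], position [L + p] is devoted to the subcomputation at path [p].
    Its family is consulted at [S x] because the functions to be avoided are arguments of [pair2],
    with the tag at position 0. *)
Definition diagB (f : nat -> nat) (u c0 L t x : nat) : nat -> Prop :=
  rIf (S x - L) (fun v => v = nthK x t)
    (rLet (Run f u (pr c0 (x - L))) (fun s =>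
      rIf (kt f s) (fun v => v = 0)
        (rLet (Eval f (pr (ka f s) (S x))) (fun w v => v = ifz w 1 0)))).

Lemma diagonal f c0 (L : list nat) : halts f c0 -> (forall x, nth x L 0 <= 1) ->
  exists (R : env 1 -> nat -> Prop) (g : nat ->
  nat), Realisable 1 R /\ (forall x, R (f, x) (g x)) /\
    binary g /\ (forall x, x < length L -> g x = nth x L 0) /\
    forall s psi, Reach f c0 s -> kt f s <> 0 -> (forall m, Eval f (pr (ka f s) m) (psi m)) ->
      exists x, g x <> psi (S x).
Proof.
  intros hc hT. destruct paths as [u Hu]. destruct (Hu f c0 hc) as [Hp Hr].
  exists (fun q v => diagB (fst q) u c0 (length L) (enc L) (snd q) v).
  assert (exists g, forall x, diagB f u c0 (length L) (enc L) x (g x) /\ g x <= 1) as [g Hg].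
  { apply (dep_choice (fun x v => diagB f u c0 (length L) (enc L) x v /\ v <= 1)).
    intros x. unfold diagB.
    destruct (Nat.eq_dec (S x - length L) 0) as [E|E].
    { exists (nth x L 0). split; auto. left. split; auto. now rewrite nthK_enc. }
    destruct (Hp (x - length L)) as (s & Hs & Hrs).
    destruct (reach_halts _ _ _ Hrs hc) as [v Hv].
    inversion Hv as [c' E'|c' g v' E' Hg Hk]; subst.
    (* A subcomputation that returns at once makes no query, so any bit serves. *)
    - exists 0. split; auto. right. split; auto. exists s. split; auto. now left.
    - exists (ifz (g (S x)) 1 0). split; [|destruct (g (S x)); simpl; lia].
      right. split; auto. exists s. split; auto. right. split; auto. now exists (g (S x)). }
  exists g. repeat split.
  - unfold diagB. pe.
  - intros x. apply Hg.
  - intros x. apply Hg.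
  - intros x Hx. destruct (Hg x) as [[[_ E]|[E _]] _]; [|lia]. rewrite E. apply nthK_enc.
  - intros s psi Hs E Hpsi. destruct (Hr s Hs) as [p Hrun].
    exists (length L + p).
    destruct (Hg (length L + p)) as [[[E' _]|[_ (s' & Hs' & h)]] _]; [lia|].
    replace (length L + p - length L) with p in Hs' by lia.
    rewrite (Run_fun _ _ _ _ _ Hs' Hrun) in h. destruct h as [[E' _]|[_ (w & Hw & Ew)]]; [easy|].
    rewrite (Eval_fun _ _ _ (Hpsi _) _ Hw), Ew. destruct w; simpl; lia.
Qed.
(** * Membership in the type structure *)

Lemma Stage_0 k (x : T 0) : Stage H k 0 x.
Proof. induction k; simpl; auto. Qed.

Lemma Stage_high k : forall j (x : T j), k < j -> ~ Stage H k j x.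
Proof.
  induction k as [|k IH]; simpl; intros j x Hj; [lia|].
  intros [h|[E _]]; [|lia]. revert h. apply IH. lia.
Qed.

(** Stage [k] contains nothing of type above [k], so only the clause added at stage [S k] can
    apply. *)
Lemma Mem_S k (phi : T (S k)) : Mem H (S k) phi <-> NewMem H k (Stage H k) phi.
Proof.
  unfold Mem; simpl. split.
  - intros [h|[E h]]; [exfalso; revert h; apply Stage_high; lia|].
    now rewrite (UIP_refl_nat _ E) in h.
  - intros h. right. now exists eq_refl.
Qed.

Lemma K_Stage k e args v : Forall (fun o : Obj => projT1 o <= 2) args ->
  K e args v <-> Comp (Stage H k) e args v.
Proof. intros h. split; apply Comp_dom; auto using Stage_0. Qed.

Lemma Mem1_index g : Mem H 1 g -> exists d, forall f m, Eval f (pr (fam0 d) m) (g m).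
Proof.
  intros h. apply Mem_S in h as [_ [e he]]. exists e. intros f m.
  apply (Eval_mode1 _ _ _ _ _ 0). apply (simulation _ _ _ _ _ (he m eq_refl) [sNum m; sOH]).
  repeat constructor.
Qed.

Lemma Mem1_computable g : Mem H 1 g -> computable g.
Proof. intros h. destruct (Mem1_index g h) as [d head]. exact (computable_fam0 d g head). Qed.

Lemma Mem1_intro (R : env 1 -> nat -> Prop) f g : b = false ->
  Realisable 1 R -> (forall x, R (f, x) (g x)) -> Mem H 1 g.
Proof.
  intros Eb HR Hg. apply Mem_S. split; [now intros x y _ ->|].
  destruct (pe_index R HR) as [e He]. exists e. intros x _.
  specialize (He f x (g x) (Hg x)). unfold Run, ctx in He. now rewrite Eb in He.
Qed.

Lemma Mem1_cf g : b = false -> RealisableFun 1 (fun q => g (snd q)) -> Mem H 1 g.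
Proof. intros Eb h. now apply (Mem1_intro _ (fun _ => 0) g Eb h). Qed.

Lemma Mem1_total f d g : b = false ->
  (forall m, Eval f (pr (fam0 d) m) (g m)) -> Mem H 1 g.
Proof.
  intros Eb h. apply (Mem1_intro (fun q v => Eval (fst q) (pr (fam0 d) (snd q)) v) f g Eb); auto.
  unfold fam0. pe.
Qed.

(** * Members of type 2 *)

Definition Ind2 (F : T 2) : Prop :=
  exists c, forall g, Mem H 1 g -> K c [oF g; oH H] (F g).

Lemma Mem2_Ind2 F : Mem H 2 F -> Ind2 F.
Proof.
  intros h. apply Mem_S in h as [_ [c hc]]. exists c. intros g hg.
  apply (K_Stage 1); [repeat constructor|]. now apply hc.
Qed.

Lemma Mem2_intro (R : env 0 -> nat -> Prop) F : b = true ->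
  Realisable 0 R -> (forall f, Mem H 1 f -> R f (F f)) -> Mem H 2 F.
Proof.
  intros Eb [e He] HF. apply Mem_S. split.
  - intros x y hx hxy. f_equal. extensionality n. apply hxy. apply Stage_0.
  - exists e. intros f hf. apply K_Stage; [repeat constructor|].
    specialize (He f (F f) [] (HF f hf)). unfold ctx in He. rewrite Eb in He. exact He.
Qed.

Definition rAp1 (F : T 2) (R : nat -> nat -> Prop) (v : nat) : Prop :=
  exists g, (forall m, R m (g m)) /\ Mem H 1 g /\ v = F g.

Lemma pe_Ap1 n F (R : env n -> nat -> nat -> Prop) : Ind2 F ->
  Realisable (S n) (fun q v => R (fst q) (snd q) v) -> Realisable n (fun a v => rAp1 F (R a) v).
Proof. intros [c Hc]. now apply (pe_F c). Qed.

Ltac pe_hook ::=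
  lazymatch goal with
  | |- Realisable ?n (fun a v => rAp Ex (@?R a) v) => apply (pe_Ex n R); pe
  | |- Realisable ?n (fun a v => rAp All (@?R a) v) => apply (pe_All n R); pe
  | |- Realisable ?n (fun a v => Eval _ (@?s a) v) => apply (pe_Eval n s); cf
  | |- Realisable ?n (fun a v => opU _ (@?s a) v) => apply (pe_opU n s); cf
  | h : Ind2 ?F |- Realisable ?n (fun a v => rAp1 ?F (@?R a) v) => apply (pe_Ap1 n F R h); pe
  end.

Lemma Mem1_shift g : b = false -> Mem H 1 g -> Mem H 1 (fun m => g (S m)).
Proof. intros Eb h. apply Mem1_computable in h. apply Mem1_cf; auto. cf. Qed.

Lemma Mem1_slice Y n : b = false -> Mem H 1 Y -> Mem H 1 (fun m => Y (pr n m)).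
Proof. intros Eb h. apply Mem1_computable in h. apply Mem1_cf; auto. cf. Qed.

Lemma Mem1_cons0 g n : b = false -> Mem H 1 g -> Mem H 1 (cons0 n g).
Proof.
  intros Eb h. apply Mem1_computable in h.
  replace (cons0 n g) with (fun m => ifz m n (g (pred m))).
  - apply Mem1_cf; auto. cf.
  - extensionality m. now destruct m.
Qed.

Lemma Mem1_nth L : b = false -> Mem H 1 (fun x => nth x L 0).
Proof.
  intros Eb. apply Mem1_cf; auto.
  replace (fun q : env 1 => nth (snd q) L 0) with (fun q : env 1 => nthK (snd q) (enc L)).
  - cf.
  - extensionality q. apply nthK_enc.
Qed.

Lemma Mem1_limit Y : b = false -> Mem H 1 Y -> Mem H 1 (limit Y).
Proof. intros Eb h. apply Mem1_cf; auto. now apply cf_limit, Mem1_computable. Qed.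

Lemma ap_true f x : b = true -> ap f x = f x.
Proof. unfold ap. now intros ->. Qed.

Definition spike (g : nat -> nat) (N : nat) : T 2 :=
  fun h => ifz (All (fun x => dist (g x) (h x))) (S N) 0.

Lemma Mem2_spike g N : b = true -> Mem H 1 g -> Mem H 2 (spike g N).
Proof.
  intros Eb h. apply Mem1_computable in h.
  apply (Mem2_intro (fun f v => v = ifz (All (fun x => dist (g x) (ap f x))) (S N) 0)); auto.
  - pe.
  - intros f _. unfold spike, ap. now rewrite Eb.
Qed.

(** Its zeros [n :: f] are those with [f] binary and [F f > n]: the relation is written as an
    equation to become an instance of the choice principle. *)
Definition exceeds (F : T 2) : T 2 :=
  fun h => All (fun m => h (S m) - 1) + (S (h 0) - F (fun m => h (S m))).

(** Closure of type 1 under shifts enters as a hypothesis because it is proved with the other value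
    of [b]. *)
Lemma Mem2_exceeds F : b = true ->
  (forall g, Mem H 1 g -> Mem H 1 (fun m => g (S m))) -> Ind2 F -> Mem H 2 (exceeds F).
Proof.
  intros Eb HS HF.
  apply (Mem2_intro (fun f v => rLet (rAp1 F (fun m v => v = ap f (S m)))
    (fun w v => v = All (fun m => ap f (S m) - 1) + (S (ap f 0) - w)) v)); auto.
  - pe.
  - intros f hf. unfold exceeds, ap. rewrite Eb. exists (F (fun m => f (S m))).
    split; auto. exists (fun m => f (S m)). auto.
Qed.

Lemma Mem2_pair F G : b = true ->
  (forall g, Mem H 1 g -> Mem H 1 (fun m => g (S m))) -> Ind2 F -> Ind2 G ->
  Mem H 2 (pair2 F G).
Proof.
  intros Eb HS HF HG.
  apply (Mem2_intro (fun f v => rIf (ap f 0) (rAp1 F (fun m v => v = ap f (S m)))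
    (rAp1 G (fun m v => v = ap f (S m))) v)); auto.
  - pe.
  - intros f hf. unfold pair2, ap. rewrite Eb.
    destruct (f 0) eqn:E; simpl; [left|right]; split; auto; exists (fun m => f (S m)); auto.
Qed.

(** * The choice principle *)

Lemma qfac : b = false -> QFAC01 H.
Proof.
  intros Eb Phi HPhi Hex. apply Mem2_Ind2 in HPhi.
  pose (R := fun (q : env 1) => rAp1 Phi (fun k => rIf k (fun v => v = p1 (snd q))
     (Eval (fst q) (pr (fam0 (p2 (snd q))) (pred k))))).
  assert (HR : Realisable 1 (fun q v => R q v)). { unfold R, fam0. pe. }
  assert (Hval : forall f n d g, (forall m, Eval f (pr (fam0 d) m) (g m)) ->
    R (f, pr n d) (Phi (cons0 n g))).
  { intros f n d g hg. exists (cons0 n g). split; [|split; auto].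
    - intros k. simpl. rewrite p1_pr, p2_pr. destruct k as [|k]; [now left|].
      right. split; [easy|apply hg].
    - apply Mem1_cons0; auto. now apply (Mem1_total f d). }
  destruct (select _ HR) as [nu Hnu]. set (f := fun _ : nat => 0).
  assert (h : forall n, exists d, Run f nu n d /\ exists g,
    (forall m, Eval f (pr (fam0 d) m) (g m)) /\ Phi (cons0 n g) = 0).
  { intros n. destruct (Hnu f n) as (d & Hd & [g Hg] & h0).
    - destruct (Hex n) as (g & Mg & h0). destruct (Mem1_index g Mg) as [d Hd].
      exists d. split; [now exists g|]. rewrite <- h0. now apply Hval.
    - intros d [g Hg]. eexists. exact (Hval f n d g Hg).
    - exists d. split; auto. exists g. split; auto.
      (* By uniqueness of evaluation, the argument [g'] at which [R] applied [Phi] is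
         [cons0 n g]. *)
      destruct h0 as (g' & Hg' & _ & E). transitivity (Phi g'); [|easy]. f_equal.
      extensionality k. specialize (Hg' k). simpl in Hg'. rewrite p1_pr, p2_pr in Hg'.
      destruct k as [|k]; destruct Hg' as [[E' h]|[E' h]]; try easy.
      exact (Eval_fun _ _ _ (Hg k) _ h). }
  destruct (dep_choice _ h) as [D HD].
  assert (exists Y, forall n m, Eval f (pr (fam0 (D n)) m) (Y (pr n m))) as [Y HY].
  { destruct (dep_choice (fun x v => Eval f (pr (fam0 (D (p1 x))) (p2 x)) v)) as [Y HY].
    - intros x. destruct (HD (p1 x)) as (_ & g & Hg & _). eauto.
    - exists Y. intros n m. specialize (HY (pr n m)). now rewrite p1_pr, p2_pr in HY. }
  exists Y. split.
  - apply (Mem1_intro (fun q v => rLet (Run (fst q) nu (p1 (snd q)))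
      (fun d => Eval (fst q) (pr (fam0 d) (p2 (snd q)))) v) f Y Eb).
    + unfold fam0. pe.
    + intros x. exists (D (p1 x)). split; [apply HD|].
      specialize (HY (p1 x) (p2 x)). now rewrite pr_p in HY.
  - intros n. destruct (HD n) as (_ & g & Hg & h0). rewrite <- h0. f_equal. f_equal.
    extensionality m. exact (Eval_fun _ _ _ (HY n m) _ (Hg m)).
Qed.

(** * An injective functional of type 2 *)

Definition pure (h : nat) : Prop := p2 (p1 h) = 0 /\ p1 (p1 h) <= 2.

Lemma pure_hd mode e l : mode <= 2 -> pure (head mode 0 e l).
Proof. unfold pure, head. now rewrite !p1_pr, p2_pr. Qed.

(** In modes 0 to 2 the parameter is read only by the S7 clause, which checks the flag first, and
    both successors inherit the flag and stay within these modes. *)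
Lemma kd_pure f f' c : pure (p1 c) -> kd f c = kd f' c /\
  ((exists v, kd f c = rt v) \/ exists o a k, kd f c = st o a k /\ pure a /\ pure k).
Proof.
  intros [E0 Hm].
  assert (hk : forall e L, kle f 0 e L = kle f' 0 e L /\
    ((exists v, kle f 0 e L = rt v) \/
     exists o a k, kle f 0 e L = st o a k /\ pure a /\ pure k)).
  { intros e L. split; [reflexivity|]. unfold kle, tail. cbv zeta. cbn [ifz].
    repeat match goal with
    | |- context [ifz ?t _ _] => destruct t; cbn [ifz]
    end; first [left; eexists; reflexivity
      | right; do 3 eexists; split; [reflexivity|split; apply pure_hd; auto]]. }
  unfold kd. cbv zeta. rewrite E0.
  destruct (p1 (p1 (p1 c))) as [|[|[|]]]; cbn [ifz Nat.sub]; try apply hk; [|lia].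
  split; auto. left. eauto.
Qed.

(* With flag 0 the type-1 parameter is not consulted. *)
Lemma Eval_pure f f' c v : Eval f c v -> pure (p1 c) -> Eval f' c v.
Proof.
  induction 1 as [c E|c g v E Hg IHg Hk IHk]; intros hp;
    destruct (kd_pure f f' c hp) as [Ek Hs]; unfold kt, ka, kb in *.
  - destruct Hs as [[v Ev]|(o & a & k & Ev & _)]; rewrite Ev in *.
    + unfold rt. rewrite p2_pr, p1_pr. now apply Eval_rt.
    + unfold st in E. now rewrite p1_pr in E.
  - destruct Hs as [[w Ev]|(o & a & k & Ev & ha & hk)]; rewrite Ev in *.
    + unfold rt in E. now rewrite p1_pr in E.
    + unfold st in *. rewrite ?p2_pr, ?p1_pr, ?p2_pr in *.
      apply Eval_st with (1 := eq_sym Ek) (g := g).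
      * intros m. apply IHg. now rewrite p1_pr.
      * apply IHk. now rewrite ?p1_pr.
Qed.

Lemma coding : b = true -> exists G, Mem H 2 G /\ (forall f, Mem H 1 f -> G f <> 0) /\
  forall f f', Mem H 1 f -> Mem H 1 f' -> G f = G f' -> forall x, f x = f' x.
Proof.
  intros Eb.
  pose (R := fun (q : env 1) => rAp All (fun m =>
     rLet (Eval (fst q) (pr (fam0 (p2 (snd q))) m)) (fun w v => v = dist w (ap (fst q) m)))).
  assert (HR : Realisable 1 (fun q v => R q v)). { unfold R, fam0. pe. }
  assert (Hval : forall f n d g, (forall m, Eval f (pr (fam0 d) m) (g m)) ->
    R (f, pr n d) (All (fun m => dist (g m) (ap f m)))).
  { intros f n d g hg. exists (fun m => dist (g m) (ap f m)). split; auto.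
    intros m. exists (g m). simpl. rewrite p2_pr. split; auto. }
  destruct (select _ HR) as [nu Hnu].
  assert (h : forall f, exists v, Mem H 1 f -> exists d, v = S d /\ Run f nu 0 d /\
    forall m, Eval f (pr (fam0 d) m) (f m)).
  (* Outside type 1 the default is 0; inside, the successor keeps the value positive, so that it
     exceeds the index it codes. *)
  { intros f. destruct (classic (Mem H 1 f)) as [hf|hf]; [|exists 0; easy].
    destruct (Hnu f 0) as (d & Hd & [g Hg] & h0).
    - destruct (Mem1_index f hf) as [d Hd]. exists d. split; [now exists f|].
      assert (E : All (fun m => dist (f m) (ap f m)) = 0).
      { apply All_0. intros m. rewrite ap_true by auto. now apply dist_0. }
      pose proof (Hval f 0 d f (Hd f)) as h0. now rewrite E in h0.
    - intros d [g Hg]. eexists. exact (Hval f 0 d g Hg).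
    - exists (S d). intros _. exists d. split; auto. split; auto.
      destruct h0 as (r & Hr & E). symmetry in E. rewrite All_0 in E.
      intros m. destruct (Hr m) as (w & Hw & Ew). simpl in Hw, Ew.
      rewrite p2_pr in Hw. rewrite E, ap_true in Ew by auto. symmetry in Ew.
      apply (proj1 (dist_0 _ _)) in Ew. now subst. }
  pose (G := fun f => proj1_sig (constructive_indefinite_description _ (h f))).
  assert (HG : forall f, Mem H 1 f -> exists d, G f = S d /\ Run f nu 0 d /\
    forall m, Eval f (pr (fam0 d) m) (f m)).
  { intros f. exact (proj2_sig (constructive_indefinite_description _ (h f))). }
  clearbody G. exists G. split; [|split].
  - apply (Mem2_intro (fun f v => rLet (Run f nu 0) (fun d v => v = S d) v)); auto; [pe|].
    intros f hf. destruct (HG f hf) as (d & Ed & Hd & _). now exists d.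
  - intros f hf. destruct (HG f hf) as (d & -> & _). easy.
  - intros f f' hf hf' E x.
    destruct (HG f hf) as (d & Ed & _ & Hd). destruct (HG f' hf') as (d' & Ed' & _ & Hd').
    rewrite Ed, Ed' in E. injection E as <-.
    (* The common index was found with two different parameters; run with flag 0, it computes the
       same function under both. *)
    apply (Eval_fun _ _ _ (Hd x)). apply (Eval_pure f'); [apply Hd'|].
    rewrite p1_pr. apply pure_hd. auto.
Qed.

(** * Insensitivity of type-3 objects *)

Inductive arg := argN (n : nat) | argF | argH.

(** Argument lists are kept symbolic: should [F0] equal [H], the objects alone would not show which
    entries are to be replaced by [F1]. *)
Definition arg_obj (F : T 2) (y : arg) : Obj :=
  match y with argN n => onum n | argF => existT T 2 F | argH => oH H end.

Definition arg_sym (c : nat) (y : arg) : nat :=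
  match y with argN n => sNum n | argF => sO2 c | argH => sOH end.

Lemma arg_obj_num F y x : arg_obj F y = onum x -> y = argN x.
Proof.
  destruct y as [n| |]; intros E; try discriminate E.
  now apply (existT_T_inj 0) in E as ->.
Qed.

Definition represents (f : nat -> nat) (c : nat) (F : T 2) : Prop :=
  forall e l g, (forall m, Eval f (pr (head 1 1 e l) m) (g m)) ->
    Eval f (pr (head 0 1 c (enc [sClo e l; sOH])) 0) (F g).

Section Follow.
Variables (f : nat -> nat) (c : nat) (F0 F1 : T 2).
Hypothesis Hc : represents f c F0.

(* The families queried in the computation from [d] do not separate F0 from F1. *)
Definition Good (d : nat) : Prop :=
  forall s psi, Reach f d s -> kt f s <> 0 -> (forall m, Eval f (pr (ka f s) m) (psi m)) ->
    F0 psi = F1 psi.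

Lemma Good_kd d d' : kd f d = kd f d' -> Good d -> Good d'.
Proof.
  intros E h s psi hr. destruct hr as [d'|d' m s Ek hr|d' g s Ek Hg hr].
  - unfold kt, ka. rewrite <- E. apply h. constructor.
  - apply h. apply reach_a with m; unfold kt, ka in *; now rewrite E.
  - apply h. apply reach_b with g; unfold kt, ka, kb in *; now rewrite E.
Qed.

Lemma Good_a d o a k m : kd f d = st o a k -> Good d -> Good (pr a m).
Proof.
  intros E h s psi hr. apply h. apply reach_a with m; unfold kt, ka; rewrite E; unfold st;
    now rewrite ?p2_pr, ?p1_pr.
Qed.

Lemma Good_b d o a k g : kd f d = st o a k -> (forall m, Eval f (pr a m) (g m)) ->
  Good d -> Good (pr k (op (S o) g)).
Proof.
  intros E Hg h s psi hr. apply h. apply reach_b with g; unfold kt, ka, kb; rewrite E; unfold st;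
    now rewrite ?p2_pr, ?p1_pr, ?p2_pr.
Qed.

Lemma Good_tail d fl e l : kd f d = tail fl e l -> Good d -> Good (pr (head 0 fl e l) 0).
Proof.
  intros E. apply (Good_b _ _ _ _ (fun m => m) E). intros m. apply Eval_rt, kd_2.
Qed.

Lemma Good_mode1 fl e l m w :
  Good (pr (head 1 fl e l) m) -> Good (pr (head 0 fl e (consK (sNum m) l)) w).
Proof. apply Good_kd. now rewrite kd_0, kd_1. Qed.

Lemma Rep_args l : Forall2 (Rep f 1) (map (arg_sym c) l) (map (arg_obj F0) l).
Proof.
  induction l as [|[n| |] l IH]; simpl; constructor; auto using Rep.
Qed.

(** The interpreter runs alongside the computation and hands [Good] down to each subcomputation. At
    an S8 call of [F0], the abstraction is the family of the current configuration, so [F1] returns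
    the same value on it. *)
Lemma follow e args v : K e args v -> forall l, args = map (arg_obj F0) l ->
  Good (pr (head 0 1 e (enc (map (arg_sym c) l))) 0) -> K e (map (arg_obj F1) l) v.
Proof.
  intros C. induction C as
    [e x rest D|e q args D|e x rest D|e e1 e2 args m n D C2 IH2 C1 IH1
    |e e1 e2 rest n D C IH|e e1 e2 x rest m n D C1 IH1 C2 IH2
    |e i e1 args n D Hi C IH|e g x rest D|e e1 j F rest psi n D C IH En
    |e m a args n D Hm C IH]; intros l El G; kle_step D E.
  - destruct l as [|y l]; [easy|]. injection El as Ey ->. symmetry in Ey.
    apply arg_obj_num in Ey as ->. now apply c1.
  - now apply c2.
  - destruct l as [|y l]; [easy|]. injection El as Ey ->. symmetry in Ey.
    apply arg_obj_num in Ey as ->. now apply c3.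
  - subst args.
    assert (Ek : kd f (pr (head 0 1 e (enc (map (arg_sym c) l))) 0) =
      st 1 (head 0 1 e2 (enc (map (arg_sym c) l))) (head 1 1 e1 (enc (map (arg_sym c) l)))).
    { rewrite kd_0. kle_simpl. reflexivity. }
    eapply c4; [exact D|apply IH2; auto; exact (Good_a _ _ _ _ 0 Ek G)|].
    apply (IH1 (argN m :: l)); auto. apply Good_mode1.
    apply (Good_b _ _ _ _ (fun _ => m) Ek); auto.
    intros w. eapply Eval_kd; [|exact (simulation _ _ _ _ _ C2 _ (Rep_args l))].
    now rewrite !kd_0.
  - destruct l as [|y l]; [easy|]. injection El as Ey ->. symmetry in Ey.
    apply arg_obj_num in Ey as ->. eapply c5a; [exact D|]. apply IH; auto.
    eapply Good_tail; [|exact G]. rewrite kd_0. cbn [map enc arg_sym]. kle_simpl. reflexivity.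
  - destruct l as [|y l]; [easy|]. injection El as Ey ->. symmetry in Ey.
    apply arg_obj_num in Ey as ->.
    assert (Ek : kd f (pr (head 0 1 e (enc (map (arg_sym c) (argN (S x) :: l)))) 0) =
      st 1 (head 0 1 e (enc (map (arg_sym c) (argN x :: l))))
           (head 1 1 e2 (enc (map (arg_sym c) (argN x :: l))))).
    { rewrite kd_0. cbn [map enc arg_sym]. kle_simpl. reflexivity. }
    eapply c5b; [exact D|apply (IH1 (argN x :: l)); auto; exact (Good_a _ _ _ _ 0 Ek G)|].
    apply (IH2 (argN m :: argN x :: l)); auto. apply Good_mode1.
    apply (Good_b _ _ _ _ (fun _ => m) Ek); auto.
    intros w. eapply Eval_kd; [|exact (simulation _ _ _ _ _ C1 _ (Rep_args (argN x :: l)))].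
    now rewrite !kd_0.
  - subst args. rewrite length_map in Hi.
    eapply c6; [exact D|now rewrite length_map|].
    change (onum 0) with (arg_obj F1 (argN 0)). rewrite map_nth. unfold removenth.
    rewrite firstn_map, skipn_map, <- map_app.
    apply (IH (nth i l (argN 0) :: firstn i l ++ skipn (S i) l)).
    + change (onum 0) with (arg_obj F0 (argN 0)). rewrite map_nth. unfold removenth.
      now rewrite firstn_map, skipn_map, <- map_app.
    + eapply Good_tail; [|exact G]. rewrite kd_0. kle_simpl.
      rewrite nthK_enc, skipK_enc, catK_enc by (rewrite length_map; lia).
      cbn [map enc]. rewrite map_app, firstn_map, skipn_map.
      now rewrite <- (map_nth (arg_sym c) l (argN 0) i).
  (* These lists contain no object of type 1, so S7 cannot occur. *)
  - destruct l as [|[n'| |] l]; discriminate El.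
  - destruct l as [|y l]; [easy|]. injection El as Ey ->.
    assert (j = 0) as ->. { destruct y; try discriminate Ey; now injection Ey. }
    assert (Ek : exists o k, kd f (pr (head 0 1 e (enc (map (arg_sym c) (y :: l)))) 0) =
      st o (head 1 1 e1 (enc (map (arg_sym c) (y :: l)))) k).
    { destruct y; try discriminate Ey; do 2 eexists; rewrite kd_0; cbn [map enc arg_sym];
        kle_simpl; reflexivity. }
    destruct Ek as (o & k & Ek).
    assert (C' : forall m, K e1 (map (arg_obj F1) (argN m :: y :: l)) (psi m)).
    { intros m. apply (IH m eq_refl (argN m :: y :: l)).
      - simpl. now rewrite Ey.
      - apply Good_mode1. exact (Good_a _ _ _ _ m Ek G). }
    destruct y as [n'| |]; [discriminate Ey| |]; apply (existT_T_inj 2) in Ey; subst F.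
    + apply (c8 _ _ e1 0 F1 _ psi); [exact D|intros m _; exact (C' m)|].
      rewrite En. apply (G (pr (head 0 1 e (enc (map (arg_sym c) (argF :: l)))) 0)).
      * constructor.
      * unfold kt. rewrite Ek. unfold st. now rewrite p1_pr.
      * intros m. unfold ka. rewrite Ek. unfold st. rewrite p2_pr, p1_pr.
        apply (Eval_mode1 _ _ _ _ _ 0).
        apply (simulation _ _ _ _ _ (C m eq_refl) (map (arg_sym c) (argN m :: argF :: l))).
        apply (Rep_args (argN m :: argF :: l)).
    + apply (c8 _ _ e1 0 H _ psi); [exact D|intros m _; exact (C' m)|exact En].
  - destruct l as [|y l]; [easy|]. injection El as Ey ->. symmetry in Ey.
    apply arg_obj_num in Ey as ->. rewrite length_map in Hm.
    match goal with h : exists _, _ |- _ => destruct h as [k E] end.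
    cbn [map arg_obj]. eapply c9; [exact D|now rewrite length_map|]. rewrite firstn_map.
    apply IH; [now rewrite firstn_map|].
    eapply Good_tail; [|exact G]. rewrite kd_0. cbn [map enc arg_sym]. kle_simpl.
    rewrite catK_enc_0, firstn_map by (rewrite length_map; lia). reflexivity.
Qed.

End Follow.

(** The index of [F] is correct only on members of type 1, but a closure that is total in the
    interpreter is such a member: its code yields an index. *)
Lemma index_represents f c F : b = false ->
  (forall g, Mem H 1 g -> K c [oF g; oH H] (F g)) -> represents f c F.
Proof.
  intros Eb Hc e l g Hg.
  apply (simulation _ _ _ _ _ (Hc g (Mem1_intro
    (fun q v => Eval (fst q) (pr (head 1 1 e l) (snd q)) v) f g Eb ltac:(pe) Hg)) [sClo e l; sOH]).
  repeat constructor. exact Hg.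
Qed.

(* The witness is diagonal against all type-1 objects that Mo queries on F0. *)
Lemma type3_insensitive (Mo : T 3) F0 L : b = false -> Mem H 3 Mo -> Mem H 2 F0 ->
  (forall x, nth x L 0 <= 1) ->
  exists g, Mem H 1 g /\ binary g /\ (forall x, x < length L -> g x = nth x L 0) /\
    forall F1, Mem H 2 F1 ->
      (forall psi, (exists x, g x <> psi (S x)) -> F0 psi = F1 psi) -> Mo F1 = Mo F0.
Proof.
  intros Eb hM h0 hL. apply Mem_S in hM as [_ [e he]].
  assert (He : forall F, Mem H 2 F -> K e [existT T 2 F; oH H] (Mo F)).
  { intros F hF. apply (K_Stage 2); [repeat constructor|]. now apply he. }
  destruct (Mem2_Ind2 F0 h0) as [c Hc]. set (f := fun _ : nat => 0).
  pose proof (index_represents f c F0 Eb Hc) as Rc.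
  pose proof (He F0 h0) as K0.
  pose proof (simulation _ _ _ _ _ K0 _ (Rep_args f c F0 Rc [argF; argH])) as U0.
  destruct (diagonal f _ L (ex_intro _ _ U0) hL) as (R & g & HR & Hg & Bg & Lg & Dg).
  exists g. split; [exact (Mem1_intro R f g Eb HR Hg)|]. split; auto. split; auto.
  intros F1 h1 Heq.
  assert (K1 : K e (map (arg_obj F1) [argF; argH]) (Mo F0)).
  { apply (follow f c F0 F1 Rc e _ (Mo F0) K0 [argF; argH] eq_refl).
    intros s psi hs hk hpsi. apply Heq. exact (Dg s psi hs hk hpsi). }
  destruct (Mem2_Ind2 F1 h1) as [c1 Hc1].
  pose proof (index_represents f c1 F1 Eb Hc1) as Rc1.
  (* The index of [Mo] gives [Mo F1] on [F1], and [follow] gives [Mo F0] for the same index and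
     arguments; determinism equates them. *)
  exact (Eval_fun _ _ _ (simulation _ _ _ _ _ (He F1 h1) _ (Rep_args f c1 F1 Rc1 [argF; argH])) _
    (simulation _ _ _ _ _ K1 _ (Rep_args f c1 F1 Rc1 [argF; argH]))).
Qed.

Lemma Mem2_zero : b = true -> Mem H 2 (fun _ => 0).
Proof. intros Eb. apply (Mem2_intro (fun _ v => v = 0)); auto. pe. Qed.
End Ctx.

(** * The model *)

Section Model.
Variable H : T 2.
Hypothesis normH : normal H.

Let shift g (h : Mem H 1 g) : Mem H 1 (fun m => g (S m)) := Mem1_shift H false g eq_refl h.

(* A point differing at d from the function coded by d + 1, for all d < N. *)
Lemma avoid (G : T 2) N : (forall f, Mem H 1 f -> G f <> 0) ->
  (forall f f', Mem H 1 f -> Mem H 1 f' -> G f = G f' -> forall x, f x = f' x) ->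
  exists L, length L = N /\ (forall x, nth x L 0 <= 1) /\
    forall f g, Mem H 1 f -> binary f -> (forall x, x < N -> g x = nth x L 0) ->
      extends_init f g (G f) -> N < G f.
Proof.
  intros G0 Ginj.
  assert (h : forall d, exists v, v <= 1 /\
    forall f, Mem H 1 f -> binary f -> G f = S d -> v <> f d).
  { intros d. destruct (classic (exists f, Mem H 1 f /\ binary f /\ G f = S d))
      as [(f & Mf & Bf & Ef)|Hn].
    - exists (1 - f d). split; [lia|]. intros f' Mf' Bf' Ef'.
      (* The flipped bit of one [f] serves every [f'] of the same code, since the two are equal. *)
      rewrite <- (Ginj f f' Mf Mf' (eq_trans Ef (eq_sym Ef')) d). specialize (Bf d). lia.
    - exists 0. split; [lia|]. intros f Mf Bf Ef. exfalso. eauto. }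
  destruct (dep_choice _ h) as [t Ht].
  exists (map t (seq 0 N)). split; [now rewrite length_map, length_seq|].
  assert (Hnth : forall x, x < N -> nth x (map t (seq 0 N)) 0 = t x).
  { intros x Hx. rewrite nth_indep with (d' := t 0) by (now rewrite length_map, length_seq).
    now rewrite map_nth, seq_nth. }
  split.
  - intros x. destruct (Nat.lt_ge_cases x N) as [Hx|Hx].
    + rewrite Hnth by auto. apply Ht.
    + rewrite nth_overflow; [lia|]. now rewrite length_map, length_seq.
  - intros f g Mf Bf Hg Hext. destruct (Nat.lt_ge_cases N (G f)) as [|Hle]; auto. exfalso.
    (* With [G f = S d], position [d] lies inside the initial segment of length [G f], where [g]
       would have to agree with [f]. *)
    specialize (G0 f Mf). destruct (G f) as [|d] eqn:Ed; [easy|].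
    destruct (Ht d) as [_ Hd]. apply (Hd f Mf Bf Ed).
    rewrite <- (Hnth d Hle), <- (Hg d Hle). apply Hext. lia.
Qed.

Lemma spike_self g N : spike g N g = S N.
Proof.
  unfold spike. assert (E : All (fun x => dist (g x) (g x)) = 0).
  { apply All_0. intros x. now apply dist_0. }
  now rewrite E.
Qed.

Lemma spike_other g N h x : g x <> h x -> spike g N h = 0.
Proof.
  intros Hx. unfold spike. destruct (All _) eqn:E; auto.
  rewrite All_0 in E. exfalso. now apply Hx, dist_0.
Qed.

(** Only the neighbourhoods that contain [g] constrain anything, and each of them comes from an [f]
    with [N < G f], that is, [S N <= G f]. *)
Lemma spike_LOC (G : T 2) N L g : length L = N ->
  (forall f g, Mem H 1 f -> binary f -> (forall x, x < N -> g x = nth x L 0) ->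
      extends_init f g (G f) -> N < G f) ->
  (forall x, x < N -> g x = nth x L 0) -> LOC H (spike g N) G.
Proof.
  intros HL Hav Hg f h Mf Bf Mh Bh Hext.
  destruct (classic (exists x, g x <> h x)) as [[x Hx]|Hn].
  - rewrite (spike_other g N h x Hx). lia.
  - assert (g = h) as <-.
    { extensionality x. destruct (Nat.eq_dec (g x) (h x)); auto. exfalso. eauto. }
    rewrite spike_self. now apply (Hav f g).
Qed.

Lemma not_PITu : ~ PITu H.
Proof.
  intros hP. destruct (coding H true normH eq_refl) as (G & MG & G0 & Ginj).
  destruct (hP G MG) as [N HN]. destruct (avoid G N G0 Ginj) as (L & HL & BL & Hav).
  set (g := fun x => nth x L 0).
  assert (Mg : Mem H 1 g) by now apply (Mem1_nth H false).
  pose proof (HN (spike g N) (Mem2_spike H true normH g N eq_refl Mg)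
    (spike_LOC G N L g HL Hav (fun x _ => eq_refl)) g Mg BL) as h.
  rewrite spike_self in h. lia.
Qed.

Lemma not_WPR (Mo : T 3) : Mem H 3 Mo -> ~ WPR H Mo.
Proof.
  intros MMo hW. destruct (coding H true normH eq_refl) as (G & MG & G0 & Ginj).
  pose proof (Mem2_Ind2 H G MG) as IG.
  assert (IZ : Ind2 H (fun _ => 0)) by now apply Mem2_Ind2, (Mem2_zero H true).
  assert (MF0 : Mem H 2 (pair2 (fun _ => 0) G)) by now apply (Mem2_pair H true).
  (* The bound is read off at the zero functional before [g] exists, so [g] may depend on [N]
     without circularity. *)
  set (N := Mo (pair2 (fun _ => 0) G)).
  destruct (avoid G N G0 Ginj) as (L & HL & BL & Hav).
  destruct (type3_insensitive H false Mo _ L eq_refl MMo MF0 BL) as (g & Mg & Bg & Lg & Heq).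
  rewrite HL in Lg.
  assert (MF : Mem H 2 (spike g N)) by now apply (Mem2_spike H true).
  assert (E : Mo (pair2 (spike g N) G) = N).
  { apply Heq.
    - apply (Mem2_pair H true); auto. now apply Mem2_Ind2.
    (* The two pairs can differ only at arguments with tag 0 whose remainder is [g]. *)
    - intros psi [x Hx]. unfold pair2. destruct (psi 0 =? 0); auto.
      symmetry. exact (spike_other g N _ x Hx). }
  pose proof (hW _ _ MF MG (spike_LOC G N L g HL Hav Lg) g Mg Bg) as h.
  rewrite spike_self, E in h. lia.
Qed.

Lemma PITo_model : PITo H.
Proof.
  intros F G MF MG.
  destruct (classic (LOC H F G)) as [hL|hL]; [|now exists 0].
  apply NNPP. intros Hn.
  assert (Hex : forall n, exists f, Mem H 1 f /\ exceeds F (cons0 n f) = 0).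
  { intros n. apply NNPP. intros Hno. apply Hn. exists n. intros _ f Mf Bf.
    destruct (Nat.le_gt_cases (F f) n) as [|Hgt]; auto. exfalso. apply Hno. exists f.
    split; auto. unfold exceeds. simpl.
    assert (E : All (fun m => f m - 1) = 0).
    { apply All_0. intros m. specialize (Bf m). lia. }
    change (fun m => f m) with f. rewrite E. destruct (F f); lia. }
  pose proof (Mem2_exceeds H true normH F eq_refl shift (Mem2_Ind2 H F MF)) as ME.
  destruct (qfac H false normH eq_refl (exceeds F) ME Hex) as (Y & MY & HY).
  assert (HYn : forall n, binary (fun m => Y (pr n m)) /\ n < F (fun m => Y (pr n m))).
  { intros n. specialize (HY n). unfold exceeds in HY. cbn [cons0] in HY.
    apply Nat.eq_add_0 in HY as [h1 h2]. split.
    - intros m. rewrite All_0 in h1. specialize (h1 m). unfold pr. lia.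
    - unfold pr. lia. }
  set (f := limit Y).
  assert (Mf : Mem H 1 f) by now apply (Mem1_limit H false).
  (* [G f] is used twice: agreement below it puts row [n] into the neighbourhood of the limit, and
     [n >= G f] makes [F] exceed [G f] on that row. *)
  destruct (limit_spec Y (fun n => proj1 (HYn n)) (G f) (G f)) as (n & Hn1 & Hn2).
  pose proof (hL f (fun m => Y (pr n m)) Mf (limit_binary Y)
    (Mem1_slice H false Y n eq_refl MY) (proj1 (HYn n)) Hn2) as h.
  destruct (HYn n) as [_ h']. lia.
Qed.

End Model.

Theorem theorem3p16 (H : (nat -> nat) -> nat) :
  normal H ->
  QFAC01 H /\ ~ PITu H /\ PITo H /\
  (forall Mo : T 3, Mem H 3 Mo -> ~ WPR H Mo) /\
  (forall Mu : T 3, Mem H 3 Mu -> ~ PR H Mu).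
Proof.
  intros normH. split; [|split; [|split; [|split]]].
  - exact (qfac H false normH eq_refl).
  - exact (not_PITu H normH).
  - exact (PITo_model H normH).
  - exact (not_WPR H normH).
  - intros Mu _ hP. apply (not_PITu H normH). intros G MG. exists (Mu G).
    intros F MF. now apply hP.
Qed.
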